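(* For every integer $r\ge 2$, $$\zeta(2r+1)=-\frac{2\pi^2(3^{2r-2}-1)}{r(2r-1)(3^{2r+1}-1)}\zeta(2r-1)+\frac{2\cdot3^{2r}}{r(2r-1)(3^{2r+1}-1)}\left[\sum_{k=1}^{r-1}(-1)^{k-1}\frac{(r-k)(2r+2k-1)}{(2k)!}\left(\frac{2\pi}{3}\right)^{2k}\zeta(2r+1-2k)+(-1)^r\left(\frac{2\pi}{3}\right)^{2r}\sum_{k=0}^\infty\frac{(2k)!\,(4r+2k-1)}{(2r+2k)!}\frac{\zeta(2k)}{3^{2k}}\right].$$
   Context: $\zeta$ is the Riemann zeta function (analytically continued), so $\zeta(0)=-1/2$. An empty sum is zero. *)

(* Defs.v *)
From Stdlib Require Export Reals Factorial.
From Coquelicot Require Export Coquelicot.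

(* Stdlib real numbers with Coquelicot's complex numbers [C]. *)

Definition Cexp (z : C) : C :=
  (exp (Re z) * cos (Im z), exp (Re z) * sin (Im z))%R.

(* [dirichlet_term s n] is (n+1)^(-s), with the principal determination
   n^(-s) = exp (- s ln n); the shift makes the Dirichlet series start at 1. *)
Definition dirichlet_term (s : C) (n : nat) : C :=
  Cexp (- s * RtoC (ln (INR (S n))))%C.

Definition analytic_at (f : C -> C) (z0 : C) : Prop :=
  exists (a : nat -> C) (eps : R), (0 < eps)%R /\
    forall z : C, (Cmod (z - z0)%C < eps)%R ->
      @is_pseries C_AbsRing C_NormedModule a (z - z0)%C (f z).

(* [zeta] is the analytic continuation to C \ {1} of the Dirichlet series
   sum_(n >= 1) n^(-s), Re s > 1.  C \ {1} being connected, this determines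
   [zeta] everywhere except at the pole 1, where its value is unconstrained. *)
Definition is_riemann_zeta (zeta : C -> C) : Prop :=
  (forall s : C, (1 < Re s)%R ->
     @is_series C_AbsRing C_NormedModule (dirichlet_term s) (zeta s)) /\
  (forall s : C, s <> RtoC 1 -> analytic_at zeta s).

(* Main.v *)
(** Let C_p(x) be the p-th Clausen-type function, the sum of kap_p(n x) / n^p with
kap_1 = cos and kap_(p+1)' = kap_p, so that C_(p+1)' = C_p. The combination
W_p = p C_(p+1) - x C_p again satisfies W_(p+1)' = W_p, and W_0 is formally
x (sin x + sin 2x + ...) = (x/2) cot (x/2) = -2 sum_k zeta(2k) (x / 2 pi)^(2k).
Integrating p times from 0 gives W_p as this series integrated termwise plus a
polynomial whose coefficients are odd zeta values. At x = 2 pi / 3 the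
combination (2r-1) W_(2r) + x W_(2r-1) involves only the cosine series
C_(2r+1) and C_(2r-1), which are multiples of zeta(2r+1) and zeta(2r-1). All of
this is done on partial sums: the error in W_0 is a uniformly small term plus
cos ((N + 3/2) x) times a C^1 function, so its integrals tend to 0.

The value zeta(0) = -1/2 comes from (1 - 2^(1-s)) zeta(s) = sum_m
((2m+1)^(-s) - (2m+2)^(-s)). Both sides are real-analytic along each horizontal line
of Re s > 0 that misses the pole, so equality propagates from Re s > 1. Then let
Im s tend to 0 and s decrease to 0 on the real axis. *)

Require Import Defs.
From Stdlib Require Import Reals Factorial Lra Lia.
From Coquelicot Require Import Coquelicot.

(** Partial sums are forced: the sine series behind [W_0] diverges and [C_1] converges only
    conditionally, so no limit identity can be differentiated termwise. For truncated sums
    consecutive levels are linked by an exact derivative. One analytic estimate, at level 1, then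
    suffices; higher levels inherit it by the mean value inequality. The point [2 pi / 3] serves
    twice. It makes [x / (2 pi)] at most 1/3, where the cotangent is nonnegative and the truncation
    error is at most [9^(-N)]. Also [cos (2 pi n / 3)] is 1 or -1/2 according to whether 3 divides
    [n], which produces the factors [3^(2r+1) - 1] and [3^(2r-2) - 1]. The value [zeta(0)] is needed
    because it is the term [k = 0] of the infinite series. Complex analyticity is used only through
    the real functions Re (e^(i phi) f) on horizontal lines, for every [phi]. Multiplying by
    [2^(-ib)] is then a shift of [phi], and the identity principle becomes a supremum argument on a
    half-line. *)

Open Scope R_scope.

(* Coquelicot's sums live in the carrier of an abelian monoid, which hides from
   [ring] and [field] that the equation is over [R]. *)
Ltac real_eq := match goal with |- @eq _ ?a ?b => change (@eq R a b) end.
Ltac ring_R := real_eq; ring.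

(** * Oscillating integrals *)

(** This is [sin u / u] with the removable singularity filled in. Written as an entire power series
    in [u ^ 2], it is smooth at 0 without a case distinction. *)
Definition sinc (u : R) : R := PSeries sin_n (u ^ 2).

Lemma is_pseries_sin_n (x : R) : is_pseries sin_n x (PSeries sin_n x).
Proof.
apply PSeries_correct.
destruct (exist_sin x) as [l Hl].
exists l. apply is_pseries_R, is_series_Reals, Hl.
Qed.

Lemma CV_radius_sin_n (x : R) : Rbar_lt (Rabs x) (CV_radius sin_n).
Proof.
apply Rbar_not_le_lt. intros H.
apply (CV_disk_outside sin_n (Rabs x + 1)).
- rewrite (Rabs_pos_eq (Rabs x + 1)) by (pose proof (Rabs_pos x); lra).
  apply (Rbar_le_lt_trans _ _ _ H). simpl. lra.
- apply (ex_series_lim_0 (fun n => sin_n n * (Rabs x + 1) ^ n)).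
  exists (PSeries sin_n (Rabs x + 1)).
  apply is_pseries_R, is_pseries_sin_n.
Qed.

Lemma sin_sinc (u : R) : sin u = u * sinc u.
Proof.
unfold sin, sinc.
replace (u ^ 2) with (Rsqr u) by (unfold Rsqr; ring).
destruct (exist_sin (Rsqr u)) as [l Hl].
f_equal. symmetry. apply is_pseries_unique, is_pseries_R, is_series_Reals, Hl.
Qed.

Lemma sinc_0 : sinc 0 = 1.
Proof.
unfold sinc. replace (0 ^ 2) with 0 by ring.
rewrite PSeries_0. unfold sin_n. simpl. field.
Qed.

Lemma sinc_pos (u : R) : 0 <= u < PI -> 0 < sinc u.
Proof.
intros [[Hu|Hu] Hpi].
- apply (Rmult_lt_reg_l u); trivial. rewrite Rmult_0_r, <- sin_sinc.
  now apply sin_gt_0.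
- rewrite <- Hu, sinc_0. lra.
Qed.

(** The oscillating amplitudes below have [sinc] in the denominator. Integration by parts needs
    bounds on their derivatives, which come from continuity, hence from a second derivative of
    [sinc]. *)
Lemma sinc_C2 : exists ds : R -> R,
  (forall u, is_derive sinc u (ds u)) /\ (forall u, ex_derive ds u).
Proof.
exists (fun u => 2 * u * PSeries (PS_derive sin_n) (u ^ 2)). split; intros u.
- unfold sinc. auto_derive.
  + apply (ex_derive_PSeries sin_n), CV_radius_sin_n.
  + rewrite (Derive_PSeries sin_n) by apply CV_radius_sin_n.
    replace (u * (u * 1)) with (u ^ 2) by ring. ring.
- auto_derive.
  apply (ex_derive_PSeries (PS_derive sin_n)). rewrite CV_radius_derive. apply CV_radius_sin_n.
Qed.

Lemma ex_derive_sinc (u : R) : ex_derive sinc u.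
Proof. destruct sinc_C2 as [ds [H _]]. now exists (ds u). Qed.

Lemma ex_derive_Derive_sinc (u : R) : ex_derive (Derive sinc) u.
Proof.
destruct sinc_C2 as [ds [H1 H2]].
apply (ex_derive_ext ds); trivial.
intros t. symmetry. now apply is_derive_unique.
Qed.

Lemma bounded_of_continuous (f : R -> R) (X : R) :
  0 <= X -> (forall x, 0 <= x <= X -> continuous f x) ->
  exists B, 0 <= B /\ forall x, 0 <= x <= X -> Rabs (f x) <= B.
Proof.
intros HX Hf.
destruct (continuity_ab_maj (fun x => Rabs (f x)) 0 X HX) as [m [Hm _]].
- intros c Hc. apply continuity_pt_filterlim.
  apply (continuous_comp f Rabs); [now apply Hf|].
  apply continuity_pt_filterlim, Rcontinuity_abs.
- exists (Rabs (f m)). split; [apply Rabs_pos|exact Hm].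
Qed.

Lemma bound_of_derive_ab (f df : R -> R) (B a b : R) :
  a <= b -> (forall t, a <= t <= b -> is_derive f t (df t) /\ Rabs (df t) <= B) ->
  Rabs (f b - f a) <= B * (b - a).
Proof.
intros Hx Hd.
destruct (MVT_gen f a b df) as [c [Hc E]].
- intros t Ht. rewrite Rmin_left, Rmax_right in Ht by lra. apply Hd; lra.
- intros t Ht. rewrite Rmin_left, Rmax_right in Ht by lra.
  apply continuity_pt_filterlim, (ex_derive_continuous f).
  exists (df t). apply Hd; lra.
- rewrite Rmin_left, Rmax_right in Hc by lra.
  rewrite E, Rabs_mult, (Rabs_pos_eq (b - a)) by lra.
  apply Rmult_le_compat_r; [lra|]. now apply Hd.
Qed.

Lemma bound_of_derive (f df : R -> R) (B x : R) :
  0 <= x -> (forall t, 0 <= t <= x -> is_derive f t (df t) /\ Rabs (df t) <= B) ->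
  Rabs (f x - f 0) <= B * x.
Proof.
intros Hx Hd. replace (B * x) with (B * (x - 0)) by ring.
now apply (bound_of_derive_ab f df).
Qed.

(* Integration by parts without integrals: [F - h sin (M x + phi) / M] has a
   derivative of size [e + B / M]. *)
Lemma riemann_lebesgue (h dh F eps : R -> R) (X M phi e A B : R) :
  0 < M -> 0 <= X ->
  (forall x, 0 <= x <= X -> is_derive h x (dh x) /\ Rabs (h x) <= A /\ Rabs (dh x) <= B) ->
  (forall x, 0 <= x <= X ->
     is_derive F x (eps x + h x * cos (M * x + phi)) /\ Rabs (eps x) <= e) ->
  Rabs (F X - F 0) <= (e + B / M) * X + 2 * A / M.
Proof.
intros HM HX Hh HF.
set (G := fun x => F x - h x * sin (M * x + phi) / M).
assert (HG : Rabs (G X - G 0) <= (e + B / M) * X).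
{ apply (bound_of_derive G (fun x => eps x - dh x * sin (M * x + phi) / M)); trivial.
  intros t Ht. destruct (Hh t Ht) as [D1 [_ D2]]. destruct (HF t Ht) as [D3 D4].
  split.
  - unfold G. auto_derive.
    + split; [now exists (eps t + h t * cos (M * t + phi))|].
      split; [now exists (dh t)|trivial].
    + replace (Derive (fun x : R => F x) t) with (eps t + h t * cos (M * t + phi))
        by (symmetry; apply is_derive_unique, D3).
      replace (Derive (fun x : R => h x) t) with (dh t)
        by (symmetry; apply is_derive_unique, D1).
      field. lra.
  - eapply Rle_trans; [apply Rabs_triang|]. apply Rplus_le_compat; trivial.
    rewrite Rabs_Ropp. unfold Rdiv. rewrite Rabs_mult, (Rabs_pos_eq (/ M)).
    2:{ apply Rlt_le, Rinv_0_lt_compat, HM. }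
    apply Rmult_le_compat_r; [apply Rlt_le, Rinv_0_lt_compat, HM|].
    rewrite Rabs_mult, <- (Rmult_1_r B).
    apply Rmult_le_compat; trivial; try apply Rabs_pos.
    apply Rabs_le, SIN_bound. }
assert (Hb : forall x, 0 <= x <= X -> Rabs (h x * sin (M * x + phi) / M) <= A / M).
{ intros x Hx. destruct (Hh x Hx) as [_ [D _]].
  unfold Rdiv. rewrite Rabs_mult, (Rabs_pos_eq (/ M)).
  2:{ apply Rlt_le, Rinv_0_lt_compat, HM. }
  apply Rmult_le_compat_r; [apply Rlt_le, Rinv_0_lt_compat, HM|].
  rewrite Rabs_mult, <- (Rmult_1_r A).
  apply Rmult_le_compat; trivial; try apply Rabs_pos.
  apply Rabs_le, SIN_bound. }
pose proof (Hb X ltac:(lra)) as H1. pose proof (Hb 0 ltac:(lra)) as H2.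
replace (F X - F 0) with ((G X - G 0)
  + (h X * sin (M * X + phi) / M - h 0 * sin (M * 0 + phi) / M)) by (unfold G; ring).
eapply Rle_trans; [apply Rabs_triang|]. apply Rplus_le_compat; trivial.
eapply Rle_trans; [apply Rabs_triang|]. rewrite Rabs_Ropp.
replace (2 * A / M) with (A / M + A / M) by (field; lra). lra.
Qed.

Lemma C1_bounds (h dh : R -> R) (X : R) :
  0 <= X ->
  (forall x, 0 <= x <= X -> is_derive h x (dh x) /\ continuous dh x) ->
  exists A B, 0 <= A /\ 0 <= B /\
  forall x, 0 <= x <= X -> is_derive h x (dh x) /\ Rabs (h x) <= A /\ Rabs (dh x) <= B.
Proof.
intros HX H.
destruct (bounded_of_continuous h X HX) as [A [HA0 HA]].
{ intros x Hx. apply (ex_derive_continuous h). exists (dh x). now apply H. }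
destruct (bounded_of_continuous dh X HX) as [B [HB0 HB]].
{ intros x Hx. now apply H. }
exists A, B. do 2 (split; trivial). intros x Hx.
split; [now apply H|split; auto].
Qed.

Lemma sum_n_S (a : nat -> R) (N : nat) : sum_n a (S N) = sum_n a N + a (S N).
Proof. exact (sum_Sn a N). Qed.

Lemma sum_n_eq (a b : nat -> R) (N : nat) :
  (forall n, a n = b n) -> sum_n a N = sum_n b N.
Proof. exact (sum_n_ext a b N). Qed.

Lemma sum_n_scal (c : R) (a : nat -> R) (N : nat) :
  sum_n (fun n => c * a n) N = c * sum_n a N.
Proof. exact (sum_n_mult_l (K := R_Ring) c a N). Qed.

(** * Partial fractions of the cotangent *)

Lemma dirichlet_cos (N : nat) (x : R) :
  2 * sin (x / 2) * sum_n (fun n => cos (INR (S n) * x)) N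
  = sin ((INR (S N) + / 2) * x) - sin (x / 2).
Proof.
assert (step : forall a, 2 * sin (x / 2) * cos (a * x)
  = sin ((a + / 2) * x) - sin ((a - / 2) * x)).
{ intros a.
  replace ((a + / 2) * x) with (a * x + x / 2) by field.
  replace ((a - / 2) * x) with (a * x - x / 2) by field.
  rewrite sin_plus, sin_minus. ring. }
induction N as [|N IH].
- rewrite sum_O, step. f_equal. f_equal. simpl. field.
- rewrite sum_n_S. rewrite Rmult_plus_distr_l, IH, step.
  replace (INR (S (S N)) - / 2) with (INR (S N) + / 2)
    by (rewrite (S_INR (S N)); field). ring.
Qed.

Lemma dirichlet_sin (N : nat) (x : R) :
  2 * sin (x / 2) * sum_n (fun n => sin (INR (S n) * x)) N
  = cos (x / 2) - cos ((INR (S N) + / 2) * x).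
Proof.
assert (step : forall a, 2 * sin (x / 2) * sin (a * x)
  = cos ((a - / 2) * x) - cos ((a + / 2) * x)).
{ intros a.
  replace ((a + / 2) * x) with (a * x + x / 2) by field.
  replace ((a - / 2) * x) with (a * x - x / 2) by field.
  rewrite cos_plus, cos_minus. ring. }
induction N as [|N IH].
- rewrite sum_O, step. f_equal. f_equal. simpl. field.
- rewrite sum_n_S. rewrite Rmult_plus_distr_l, IH, step.
  replace (INR (S (S N)) - / 2) with (INR (S N) + / 2)
    by (rewrite (S_INR (S N)); field). ring.
Qed.

(** The factor [x] cancels the zero of [sin (x / 2)] at the origin. What remains is
    [(x / 2) cot (x / 2)] plus an oscillation with smooth amplitude. *)
Lemma x_sum_sin (N : nat) (x : R) : 0 <= x < 2 * PI ->
  x * sum_n (fun n => sin (INR (S n) * x)) N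
  = cos (x / 2) / sinc (x / 2) - / sinc (x / 2) * cos ((INR (S N) + / 2) * x).
Proof.
intros Hx. pose proof (sinc_pos (x / 2) ltac:(lra)) as Hs.
apply (Rmult_eq_reg_l (sinc (x / 2))); [|lra].
transitivity (2 * sin (x / 2) * sum_n (fun n => sin (INR (S n) * x)) N).
- rewrite sin_sinc. field.
- rewrite dirichlet_sin. field. lra.
Qed.

Lemma lim_of_bound (u e : nat -> R) (l : R) :
  (forall n, Rabs (u n - l) <= e n) -> is_lim_seq e 0 -> is_lim_seq u l.
Proof.
intros H He.
apply (is_lim_seq_le_le (fun n => l - e n) u (fun n => l + e n)).
- intros n. specialize (H n). apply Rabs_le_between in H. lra.
- replace (Finite l) with (Finite (l - 0)) by (f_equal; ring).
  apply is_lim_seq_minus'; [apply is_lim_seq_const|exact He].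
- replace (Finite l) with (Finite (l + 0)) by (f_equal; ring).
  apply is_lim_seq_plus'; [apply is_lim_seq_const|exact He].
Qed.

Lemma lim_div_half_integer (K : R) :
  is_lim_seq (fun N => K / (INR (S N) + / 2)) 0.
Proof.
replace (Finite 0) with (Rbar_mult K 0) by (simpl; f_equal; ring).
apply is_lim_seq_scal_l.
replace (Finite 0) with (Rbar_inv p_infty) by reflexivity.
apply is_lim_seq_inv; [|discriminate].
apply (is_lim_seq_le_p_loc INR); [|apply is_lim_seq_INR].
exists 0%nat. intros n _. rewrite S_INR. lra.
Qed.

Lemma sin_nat_PI (n : nat) : sin (INR n * PI) = 0.
Proof.
induction n as [|n IH]; [simpl; rewrite Rmult_0_l; apply sin_0|].
rewrite S_INR, Rmult_plus_distr_r, Rmult_1_l, neg_sin, IH. ring.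
Qed.

(* [cos (t (PI - u)) (1 + 2 sum cos (n u))] has an explicit antiderivative in
   [u]; comparing with the same integral for the constant [cos (t PI)] leaves
   an oscillating integral that tends to 0. *)
Lemma cot_partial_fractions (t : R) : 0 < t < 1 ->
  is_series (fun n => t ^ 2 / (INR (S n) ^ 2 - t ^ 2))
    ((1 - cos (PI * t) / sinc (PI * t)) / 2).
Proof.
intros Ht. pose proof PI_RGT_0 as Hpi.
assert (Hm : forall n, t ^ 2 < INR (S n) ^ 2).
{ intros n. assert (1 <= INR (S n)) by (rewrite S_INR; pose proof (pos_INR n); lra). nra. }
set (c := fun u => cos (t * (PI - u))). set (s := fun u => sin (t * (PI - u))).
set (F := fun N u =>
  (- s u / t + sum_n (fun n => 2 * (- INR (S n) * sin (INR (S n) * u) * c u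
      - t * cos (INR (S n) * u) * s u) / (t ^ 2 - INR (S n) ^ 2)) N)
  - cos (PI * t) * (u + sum_n (fun n => 2 * sin (INR (S n) * u) / INR (S n)) N)).
(* This is [(c u - cos (PI * t)) / sin (u / 2)]: the numerator equals
   [2 sin (PI t - t u / 2) sin (t u / 2)], so its zero at [u = 0] cancels and the amplitude is
   smooth on [[0, PI]]. *)
set (h := fun u => 2 * t * sin (PI * t - t * u / 2) * sinc (t * u / 2) / sinc (u / 2)).
assert (Hs : forall u, 0 <= u <= PI -> sinc (u / 2) <> 0).
{ intros u Hu. apply Rgt_not_eq, sinc_pos. lra. }
assert (DF : forall N u, 0 <= u <= PI ->
  is_derive (F N) u (h u * sin ((INR (S N) + / 2) * u))).
{ intros N u Hu.
  replace (h u * sin ((INR (S N) + / 2) * u)) with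
    ((c u + sum_n (fun n => 2 * cos (INR (S n) * u) * c u) N)
     - cos (PI * t) * (1 + sum_n (fun n => 2 * cos (INR (S n) * u)) N)).
  - unfold F. apply (is_derive_minus (K := R_AbsRing) (V := R_NormedModule)).
    + apply (is_derive_plus (K := R_AbsRing) (V := R_NormedModule)).
      * unfold c, s. auto_derive; trivial. unfold Rminus. field. lra.
      * apply (is_derive_sum_n (K := R_AbsRing) (V := R_NormedModule)).
        intros n _. unfold c, s. specialize (Hm n). generalize dependent (INR (S n)).
        intros m Hm. auto_derive; trivial. unfold Rminus. field. nra.
    + apply is_derive_scal. apply (is_derive_plus (K := R_AbsRing) (V := R_NormedModule)).
      * apply (is_derive_id (K := R_AbsRing)).
      * apply (is_derive_sum_n (K := R_AbsRing) (V := R_NormedModule)).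
        intros n _. pose proof (not_0_INR (S n) ltac:(lia)) as Hn. generalize dependent (INR (S n)).
        intros m Hn. auto_derive; trivial. field. exact Hn.
  - rewrite (sum_n_eq (fun n => 2 * cos (INR (S n) * u) * c u)
      (fun n => (2 * c u) * cos (INR (S n) * u)))
      by (intros n; ring).
    rewrite !sum_n_scal.
    pose proof (dirichlet_cos N u) as E.
    set (S0 := sum_n (fun n => cos (INR (S n) * u)) N) in *.
    replace (sin ((INR (S N) + / 2) * u)) with (u * sinc (u / 2) * (/ 2 + S0)).
    2:{ replace (sin ((INR (S N) + / 2) * u)) with (2 * sin (u / 2) * S0 + sin (u / 2)) by lra.
        rewrite (sin_sinc (u / 2)). field. }
    unfold h.
    transitivity ((c u - cos (PI * t)) * (1 + 2 * S0)); [ring|].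
    replace (c u - cos (PI * t)) with
      (2 * sin (PI * t - t * u / 2) * sin (t * u / 2)).
    + rewrite (sin_sinc (t * u / 2)). field. now apply Hs.
    + unfold c. rewrite <- (Ropp_involutive (cos (PI * t))).
      replace (t * (PI - u)) with ((PI * t - t * u / 2) - t * u / 2) by field.
      replace (PI * t) with ((PI * t - t * u / 2) + t * u / 2) at 3 by field.
      rewrite cos_plus, cos_minus. ring. }
destruct (C1_bounds h (Derive h) PI) as [A [B [HA [HB Hh]]]]; [lra| |].
{ intros x Hx.
  pose proof (Hs x Hx) as Hsx.
  assert (D : forall y, sinc (y / 2) <> 0 -> is_derive h y
    (2 * t * (- t / 2 * cos (PI * t - t * y / 2) * sinc (t * y / 2)
       + sin (PI * t - t * y / 2) * (t / 2 * Derive sinc (t * y / 2))) / sinc (y / 2)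
     - 2 * t * sin (PI * t - t * y / 2) * sinc (t * y / 2)
       * (Derive sinc (y / 2) / 2) / sinc (y / 2) ^ 2)).
  { intros y Hy. unfold h. auto_derive.
    - repeat split; trivial; apply ex_derive_sinc.
    - replace (Derive (fun x0 : R => sinc x0)) with (Derive sinc) by reflexivity.
      unfold Rminus, Rdiv. field. exact Hy. }
  split; [apply Derive_correct; eexists; apply (D x Hsx)|].
  assert (L : locally x (fun y => sinc (y / 2) <> 0)).
  { assert (Cs : continuous (fun y => sinc (y / 2)) x).
    { apply (ex_derive_continuous (fun y => sinc (y / 2))). auto_derive.
      apply ex_derive_sinc. }
    apply (Cs (fun z => z <> 0)). apply (open_neq 0). exact Hsx. }
  eapply continuous_ext_loc.
  { eapply filter_imp; [|exact L]. intros y Hy. symmetry.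
    apply is_derive_unique, (D y Hy). }
  apply (ex_derive_continuous (K := R_AbsRing) (V := R_NormedModule)). auto_derive.
  repeat split; try apply ex_derive_sinc; try apply ex_derive_Derive_sinc; trivial.
  all: simpl; nra. }
assert (Hsp : 0 < sinc (PI * t)) by (apply sinc_pos; nra).
set (K := (B * PI + 2 * A) / (2 * PI * sinc (PI * t))).
apply (lim_of_bound _ (fun N => K / (INR (S N) + / 2))); [|apply lim_div_half_integer].
intros N.
assert (HM : 0 < INR (S N) + / 2) by (rewrite S_INR; pose proof (pos_INR N); lra).
(* The phase [- (PI / 2)] turns the cosine of [riemann_lebesgue] into the sine of the Dirichlet
   kernel. *)
assert (Hb := riemann_lebesgue h (Derive h) (F N) (fun _ => 0) PI (INR (S N) + / 2)
  (- (PI / 2)) 0 A B HM ltac:(lra) Hh).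
(* All [sin (n PI)] vanish, as does [s PI]. The boundary values therefore reduce to the error of the
   partial sum times a fixed nonzero factor. *)
assert (E : F N PI - F N 0 = - (2 * PI * sinc (PI * t)) *
  (sum_n (fun n => t ^ 2 / (INR (S n) ^ 2 - t ^ 2)) N
   - (1 - cos (PI * t) / sinc (PI * t)) / 2)).
{ unfold F, s, c.
  replace (t * (PI - PI)) with 0 by ring. replace (t * (PI - 0)) with (PI * t) by ring.
  rewrite sin_0.
  rewrite (sum_n_eq (fun n => 2 * (- INR (S n) * sin (INR (S n) * PI) * cos 0
    - t * cos (INR (S n) * PI) * 0) / (t ^ 2 - INR (S n) ^ 2)) (fun _ => 0)).
  2:{ intros n. rewrite sin_nat_PI. unfold Rdiv. ring. }
  rewrite (sum_n_eq (fun n => 2 * sin (INR (S n) * PI) / INR (S n)) (fun _ => 0)).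
  2:{ intros n. rewrite sin_nat_PI. unfold Rdiv. ring. }
  rewrite (sum_n_eq (fun n => 2 * sin (INR (S n) * 0) / INR (S n)) (fun _ => 0)).
  2:{ intros n. rewrite Rmult_0_r, sin_0. unfold Rdiv. ring. }
  rewrite (sum_n_eq (fun n => 2 * (- INR (S n) * sin (INR (S n) * 0) * cos (PI * t)
    - t * cos (INR (S n) * 0) * sin (PI * t)) / (t ^ 2 - INR (S n) ^ 2))
    (fun n => (2 * PI * sinc (PI * t)) * (t ^ 2 / (INR (S n) ^ 2 - t ^ 2)))).
  2:{ intros n. rewrite Rmult_0_r, sin_0, cos_0, (sin_sinc (PI * t)).
      specialize (Hm n). field. nra. }
  rewrite sum_n_scal, sum_n_const.
  rewrite (sin_sinc (PI * t)). field. split; lra. }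
rewrite E, Rabs_mult, Rabs_Ropp, (Rabs_pos_eq (2 * PI * sinc (PI * t))) in Hb by nra.
assert (H2 : 0 < 2 * PI * sinc (PI * t)) by nra.
apply (Rmult_le_reg_l (2 * PI * sinc (PI * t))); trivial.
eapply Rle_trans; [apply Hb|].
- intros x Hx. split; [|rewrite Rabs_R0; lra].
  replace (0 + _) with (h x * sin ((INR (S N) + / 2) * x)); [now apply DF|].
  rewrite Rplus_0_l. f_equal. rewrite <- cos_shift, <- cos_neg. f_equal. ring.
- right. unfold K. field. split; [|split]; lra.
Qed.

Lemma is_series_le (a b : nat -> R) (la lb : R) :
  is_series a la -> is_series b lb -> (forall n, a n <= b n) -> la <= lb.
Proof.
intros Ha Hb Hab.
assert (H : Rbar_le la lb); [|exact H].
apply (is_lim_seq_le (sum_n a) (sum_n b)); trivial.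
intros n. induction n as [|n IH]; [rewrite !sum_O; apply Hab|].
rewrite !sum_n_S. specialize (Hab (S n)). lra.
Qed.

Lemma is_series_congr (a b : nat -> R) (la lb : R) :
  (forall n, a n = b n) -> la = lb -> is_series a la -> is_series b lb.
Proof. intros H <-. now apply is_series_ext. Qed.

Lemma is_series_sub_scal (c : R) (a b : nat -> R) (la lb : R) :
  is_series a la -> is_series b lb ->
  is_series (fun n => a n - c * b n) (la - c * lb).
Proof.
intros Ha Hb.
exact (is_series_minus (K := R_AbsRing) (V := R_NormedModule) _ _ _ _ Ha
  (is_series_scal_l c _ _ Hb)).
Qed.

Lemma is_series_R0 : is_series (fun _ => 0) 0.
Proof.
change (is_lim_seq (sum_n (fun _ => 0)) 0).
apply (is_lim_seq_ext (fun _ => 0)); [|apply is_lim_seq_const].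
intros n. rewrite sum_n_const. ring.
Qed.

(* [z] interpolates zeta at the integers that occur: the value at 0 makes the
   expansion of [x cot x] uniform in [k]. *)
Definition zeta_values (z : nat -> R) : Prop :=
  z 0%nat = - / 2 /\
  forall s, (2 <= s)%nat -> is_series (fun n => / INR (S n) ^ s) (z s).

(** With [q = (t / n)^2], each partial fraction is the geometric series [q / (1 - q)]. Removing the
    terms up to [q^K] leaves [q^K] times the same fraction, and summing the removed ones over [n]
    gives zeta values. The choice [z 0 = - / 2] absorbs the constant 1/2 at [K = 0]. *)
Lemma cot_remainder_series (z : nat -> R) (Hz : zeta_values z) (t : R) (K : nat) :
  0 < t < 1 ->
  is_series (fun n => t ^ 2 / (INR (S n) ^ 2 - t ^ 2) * (t / INR (S n)) ^ (2 * K))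
    (- (cos (PI * t) / sinc (PI * t)) / 2 - sum_n (fun k => z (2 * k)%nat * t ^ (2 * k)) K).
Proof.
intros Ht. destruct Hz as [Hz0 Hz].
assert (Hm : forall n, 0 < INR (S n) /\ t ^ 2 < INR (S n) ^ 2).
{ intros n. assert (1 <= INR (S n)) by (rewrite S_INR; pose proof (pos_INR n); lra). nra. }
induction K as [|K IH].
- rewrite sum_O. replace (2 * 0)%nat with 0%nat by lia. rewrite Hz0.
  replace (_ - _) with ((1 - cos (PI * t) / sinc (PI * t)) / 2) by (simpl; field;
    apply Rgt_not_eq, sinc_pos; pose proof PI_RGT_0; nra).
  eapply is_series_ext; [|now apply cot_partial_fractions].
  intros n. simpl. ring.
- rewrite sum_n_S.
  pose proof (is_series_sub_scal (t ^ (2 * S K)) _ _ _ _ IH (Hz (2 * S K)%nat ltac:(lia))) as H2.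
  revert H2. apply is_series_congr; [|ring].
  intros n.
  destruct (Hm n) as [H1 H4]. generalize dependent (INR (S n)). intros m H1 H4.
  replace (2 * S K)%nat with (2 * K + 2)%nat by lia.
  rewrite !pow_add. unfold Rdiv at 2 4. rewrite !Rpow_mult_distr, !pow_inv.
  field. repeat split; try nra. apply pow_nonzero. lra.
Qed.

(** The remainder series has terms between 0 and [(/ 9) ^ K] times those of the full series. For
    [t <= / 3] the cotangent term is nonnegative, so the full sum is at most 1/2, and the factor 2
    restores the bound. *)
Lemma cot_expansion_bound (z : nat -> R) (Hz : zeta_values z) (t : R) (K : nat) :
  0 <= t <= / 3 ->
  Rabs (cos (PI * t) / sinc (PI * t)
        - sum_n (fun k => -2 * z (2 * k)%nat * t ^ (2 * k)) K) <= (/ 9) ^ K.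
Proof.
intros Ht. pose proof PI_RGT_0 as Hpi.
rewrite (sum_n_eq _ (fun k => -2 * (z (2 * k)%nat * t ^ (2 * k)))) by (intros n; ring).
rewrite sum_n_scal.
destruct (Req_dec t 0) as [H0|H0].
- subst t. rewrite Rmult_0_r, cos_0, sinc_0.
  replace (sum_n _ K) with (z 0%nat).
  + rewrite (proj1 Hz). replace (1 / 1 - -2 * - / 2) with 0 by field.
    rewrite Rabs_R0. apply pow_le. lra.
  + induction K as [|K IH]; [rewrite sum_O; simpl; ring|].
    rewrite sum_n_S, <- IH. replace (2 * S K)%nat with (S (2 * K + 1)) by lia.
    simpl. ring.
- assert (Hs : 0 < sinc (PI * t)) by (apply sinc_pos; nra).
  assert (Hc : 0 <= cos (PI * t)) by (apply cos_ge_0; nra).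
  assert (Hk : 0 <= cos (PI * t) / sinc (PI * t)) by (now apply Rcomplements.Rdiv_le_0_compat).
  pose proof (cot_remainder_series z Hz t K ltac:(lra)) as H1.
  pose proof (cot_partial_fractions t ltac:(lra)) as H2.
  assert (Hm : forall n, 1 <= INR (S n) /\ 0 <= t ^ 2 / (INR (S n) ^ 2 - t ^ 2)).
  { intros n. assert (1 <= INR (S n)) by (rewrite S_INR; pose proof (pos_INR n); lra).
    split; trivial. apply Rcomplements.Rdiv_le_0_compat; nra. }
  assert (L1 := is_series_le _ _ _ _ is_series_R0 H1).
  assert (L2 := is_series_le _ _ _ _ H1 (is_series_scal_r ((/ 9) ^ K) _ _ H2)).
  cbv beta in L1, L2. apply Rabs_le.
  assert (H9 : 0 <= (/ 9) ^ K) by (apply pow_le; lra).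
  assert (Hq : forall n, 0 <= (t / INR (S n)) ^ (2 * K) <= (/ 9) ^ K).
  { intros n. destruct (Hm n) as [Hn _]. rewrite pow_mult.
    assert (0 <= t / INR (S n) <= / 3).
    { split; [apply Rcomplements.Rdiv_le_0_compat; lra|].
      apply Rcomplements.Rle_div_l; nra. }
    split; [apply pow_le; nra|apply pow_incr; nra]. }
  assert (L1' := L1 (fun n => Rmult_le_pos _ _ (proj2 (Hm n)) (proj1 (Hq n)))).
  assert (L2' := L2 (fun n => Rmult_le_compat_l _ _ _ (proj2 (Hm n)) (proj2 (Hq n)))).
  nra.
Qed.

(** * Iterated primitives *)

(* Normalised so that [kap (p + 1)] is a primitive of [kap p], with [kap 1 = cos]. *)
Definition kap (p : nat) (y : R) : R := - sin (y - INR p * (PI / 2)).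

(* [trig_part p = p C_{p+1} - x C_p], where [C_p] is the sum of [kap p (m x) / m ^ p]
   over [1 <= m <= N + 1]: the logarithm in [C_p] drops out of this combination. *)
Definition trig_part (p N : nat) (x : R) : R :=
  sum_n (fun n => INR p * (kap (S p) (INR (S n) * x) / INR (S n) ^ S p)
                  - x * (kap p (INR (S n) * x) / INR (S n) ^ p)) N.

(** The quotient of factorials is what [p] integrations from 0 make of [x ^ (2 * k)]. *)
Definition zeta_part (z : nat -> R) (p N : nat) (x : R) : R :=
  sum_n (fun k => -2 * z (2 * k)%nat / (2 * PI) ^ (2 * k)
     * (INR (fact (2 * k)) / INR (fact (2 * k + p))) * x ^ (2 * k + p)) N.

(** Collects the integration constants: it matches the value at 0 of [trig_part] at every level, so
    [remainder] vanishes at 0 from level 1 on. *)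
Definition taylor_part (p N : nat) (x : R) : R :=
  sum_n (fun j => trig_part j N 0 * (x ^ (p - j) / INR (fact (p - j)))) p.

Definition remainder (z : nat -> R) (p N : nat) (x : R) : R :=
  trig_part p N x - zeta_part z p N x - taylor_part p N x.

Lemma kap_S (p : nat) (y : R) : kap (S p) y = cos (y - INR p * (PI / 2)).
Proof.
unfold kap. rewrite S_INR.
replace (y - (INR p + 1) * (PI / 2)) with (- (PI / 2 - (y - INR p * (PI / 2)))) by ring.
rewrite sin_neg, sin_shift. ring.
Qed.

Lemma is_derive_sum_n_R (f : nat -> R -> R) (d : nat -> R) (N : nat) (x : R) :
  (forall k, (k <= N)%nat -> is_derive (f k) x (d k)) ->
  is_derive (fun y => sum_n (fun k => f k y) N) x (sum_n d N).
Proof. exact (is_derive_sum_n (K := R_AbsRing) (V := R_NormedModule) f N x d). Qed.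

Lemma is_derive_minus_R (f g : R -> R) (df dg x : R) :
  is_derive f x df -> is_derive g x dg -> is_derive (fun y => f y - g y) x (df - dg).
Proof. exact (is_derive_minus (K := R_AbsRing) (V := R_NormedModule) f g x df dg). Qed.

(** Differentiating [(p+1) C_{p+2} - x C_{p+1}] gives [(p+1) C_{p+1}] minus [C_{p+1}] minus [x C_p].
    The product rule lowers the coefficient exactly as the index drops. *)
Lemma is_derive_trig_part (p N : nat) (x : R) : is_derive (trig_part (S p) N) x (trig_part p N x).
Proof.
apply is_derive_sum_n_R. intros n _.
assert (Hm : INR (S n) <> 0) by (apply not_0_INR; lia).
unfold kap. rewrite (S_INR (S p)), (S_INR p).
generalize dependent (INR (S n)). generalize (INR p). intros a m Hm.
evar_last.
{ auto_derive; trivial. }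
pose proof (pow_nonzero m p Hm) as Hp. unfold Rminus, Rdiv.
replace (m * x + - ((a + 1 + 1) * (PI * / 2))) with
  (- (PI / 2 - (m * x + - ((a + 1) * (PI * / 2))))) by field.
replace (m * x + - (a * (PI * / 2))) with
  (PI / 2 + (m * x + - ((a + 1) * (PI * / 2)))) by field.
rewrite cos_neg, cos_shift, <- cos_sin.
simpl. field. split; trivial.
Qed.

Lemma is_derive_congr (f g : R -> R) (x a b : R) :
  (forall t, f t = g t) -> a = b -> is_derive f x a -> is_derive g x b.
Proof. intros H <-. now apply is_derive_ext. Qed.

Lemma is_derive_pow_fact (m : nat) (x : R) :
  is_derive (fun y => y ^ S m / INR (fact (S m))) x (x ^ m / INR (fact m)).
Proof.
pose proof (INR_fact_neq_0 m). pose proof (not_0_INR (S m) ltac:(lia)).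
rewrite fact_simpl, mult_INR.
evar_last.
{ apply (is_derive_ext (fun y => / (INR (S m) * INR (fact m)) * y ^ S m)).
  - intros t. simpl. field. now split.
  - apply is_derive_scal, is_derive_pow, (is_derive_id (K := R_AbsRing)). }
unfold one; simpl pred; simpl. field. now split.
Qed.

Lemma is_derive_zeta_part (z : nat -> R) (p N : nat) (x : R) :
  is_derive (zeta_part z (S p) N) x (zeta_part z p N x).
Proof.
apply is_derive_sum_n_R. intros k _.
replace (2 * k + S p)%nat with (S (2 * k + p)) by lia.
eapply is_derive_congr;
  [| |apply (is_derive_scal (fun y => y ^ S (2 * k + p) / INR (fact (S (2 * k + p)))) x
         (-2 * z (2 * k)%nat / (2 * PI) ^ (2 * k) * INR (fact (2 * k)))),
        is_derive_pow_fact]; [intros t|]; unfold Rdiv; ring.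
Qed.

Lemma is_derive_taylor_part (p N : nat) (x : R) : is_derive (taylor_part (S p) N) x (taylor_part p N x).
Proof.
unfold taylor_part.
(* Level [S p] has one more summand, a constant. Padding the derivative with a zero at that index
   gives both sums the same length. *)
replace (sum_n (fun j => trig_part j N 0 * (x ^ (p - j) / INR (fact (p - j)))) p) with
  (sum_n (fun j => if Nat.leb j p then trig_part j N 0 * (x ^ (p - j) / INR (fact (p - j)))
                   else 0) (S p)).
- apply is_derive_sum_n_R. intros j Hj. destruct (Nat.leb_spec j p) as [H|H].
  + replace (S p - j)%nat with (S (p - j)) by lia.
    apply is_derive_scal, is_derive_pow_fact.
  + replace (S p - j)%nat with 0%nat by lia. simpl.
    apply (is_derive_const (K := R_AbsRing) (V := R_NormedModule)).
- rewrite sum_n_S. destruct (Nat.leb_spec (S p) p); [lia|]. rewrite Rplus_0_r.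
  apply (sum_n_ext_loc (G := R_AbelianMonoid)). intros j Hj. destruct (Nat.leb_spec j p); [trivial|lia].
Qed.

Lemma is_derive_remainder (z : nat -> R) (p N : nat) (x : R) :
  is_derive (remainder z (S p) N) x (remainder z p N x).
Proof.
apply is_derive_minus_R; [apply is_derive_minus_R|].
- apply is_derive_trig_part.
- apply is_derive_zeta_part.
- apply is_derive_taylor_part.
Qed.

Lemma sum_n_R0 (a : nat -> R) (N : nat) : (forall n, a n = 0) -> sum_n a N = 0.
Proof.
intros H. rewrite (sum_n_eq _ (fun _ => 0) _ H), sum_n_const. apply Rmult_0_r.
Qed.

Lemma remainder_0 (z : nat -> R) (p N : nat) : remainder z (S p) N 0 = 0.
Proof.
unfold remainder.
replace (zeta_part z (S p) N 0) with 0.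
2:{ symmetry. apply sum_n_R0. intros k. rewrite pow_i by lia. ring. }
unfold taylor_part. rewrite sum_n_S, sum_n_ext_loc with (b := fun _ => 0).
- rewrite sum_n_const, Nat.sub_diag. simpl. field.
- intros j Hj. rewrite pow_i by lia. unfold Rdiv. rewrite Rmult_0_l. apply Rmult_0_r.
Qed.

(** Splits level 0 into a truncation error, controlled by [cot_expansion_bound] with
    [t = x / (2 * PI)], and an oscillation. The phase [+ 0] fits the form of [riemann_lebesgue]. *)
Lemma remainder_level0 (z : nat -> R) (N : nat) (x : R) : 0 <= x < 2 * PI ->
  remainder z 0 N x = cos (PI * (x / (2 * PI))) / sinc (PI * (x / (2 * PI)))
    - sum_n (fun k => -2 * z (2 * k)%nat * (x / (2 * PI)) ^ (2 * k)) N
    + - / sinc (x / 2) * cos ((INR (S N) + / 2) * x + 0).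
Proof.
intros Hx. pose proof PI_RGT_0 as Hpi.
replace (PI * (x / (2 * PI))) with (x / 2) by (field; lra).
rewrite Rplus_0_r.
unfold remainder.
replace (trig_part 0 N x) with (x * sum_n (fun n => sin (INR (S n) * x)) N).
2:{ rewrite <- sum_n_scal. apply sum_n_eq. intros n. unfold kap.
    replace (INR (S n) * x - INR 0 * (PI / 2)) with (INR (S n) * x) by (simpl; ring).
    simpl (INR 0). simpl (_ ^ 0). field. apply not_0_INR. lia. }
replace (taylor_part 0 N x) with 0.
2:{ unfold taylor_part. rewrite sum_O. unfold trig_part. rewrite sum_n_R0; [ring|].
    intros n. simpl (INR 0). ring. }
rewrite x_sum_sin by trivial.
replace (zeta_part z 0 N x) with (sum_n (fun k => -2 * z (2 * k)%nat * (x / (2 * PI)) ^ (2 * k)) N).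
2:{ apply sum_n_eq. intros k. rewrite Nat.add_0_r. unfold Rdiv at 1.
    rewrite Rpow_mult_distr, pow_inv. field. split; [apply INR_fact_neq_0|].
    apply pow_nonzero. lra. }
ring.
Qed.

(** The only place where the oscillation is integrated. [A] and [B] bound the amplitude
    [- / sinc (x / 2)] and its derivative on the whole interval, so the estimate is uniform in [x]
    and can be integrated again. *)
Lemma remainder_1_bound (z : nat -> R) (Hz : zeta_values z) : exists A B,
  forall N x, 0 <= x <= 2 * PI / 3 ->
  Rabs (remainder z 1 N x) <= (/ 9) ^ N * (2 * PI / 3) + (B * (2 * PI / 3) + 2 * A) / (INR (S N) + / 2).
Proof.
pose proof PI_RGT_0 as Hpi.
set (h := fun x => - / sinc (x / 2)).
assert (Hs : forall x, 0 <= x <= 2 * PI / 3 -> sinc (x / 2) <> 0).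
{ intros x Hx. apply Rgt_not_eq, sinc_pos. lra. }
destruct (C1_bounds h (fun x => Derive sinc (x / 2) / 2 / sinc (x / 2) ^ 2) (2 * PI / 3))
  as [A [B [HA [HB Hh]]]]; [lra| |].
{ intros x Hx. specialize (Hs x Hx). split.
  - unfold h. auto_derive; [split; [apply ex_derive_sinc|split; trivial]|].
    replace (Derive (fun x0 : R => sinc x0)) with (Derive sinc) by reflexivity.
    unfold Rdiv. field. exact Hs.
  - apply (ex_derive_continuous (K := R_AbsRing) (V := R_NormedModule)). auto_derive.
    repeat split; try apply ex_derive_sinc; try apply ex_derive_Derive_sinc; trivial.
    all: simpl; nra. }
exists A, B. intros N x Hx.
assert (HM : 0 < INR (S N) + / 2) by (rewrite S_INR; pose proof (pos_INR N); lra).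
pose proof (riemann_lebesgue h (fun x => Derive sinc (x / 2) / 2 / sinc (x / 2) ^ 2)
  (remainder z 1 N) (fun x => cos (PI * (x / (2 * PI))) / sinc (PI * (x / (2 * PI)))
    - sum_n (fun k => -2 * z (2 * k)%nat * (x / (2 * PI)) ^ (2 * k)) N) x
  (INR (S N) + / 2) 0 ((/ 9) ^ N) A B HM ltac:(lra)) as H.
rewrite remainder_0, Rminus_0_r in H.
eapply Rle_trans; [apply H|].
- intros y Hy. apply Hh. lra.
- intros y Hy. split.
  + unfold h. rewrite <- remainder_level0 by lra. apply is_derive_remainder.
  + apply cot_expansion_bound; trivial. split.
    * apply Rcomplements.Rdiv_le_0_compat; lra.
    * apply Rcomplements.Rle_div_l; lra.
- assert (0 <= (/ 9) ^ N) by (apply pow_le; lra).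
  assert (0 <= B / (INR (S N) + / 2)) by (apply Rcomplements.Rdiv_le_0_compat; lra).
  apply Rle_trans with (((/ 9) ^ N + B / (INR (S N) + / 2)) * (2 * PI / 3)
    + 2 * A / (INR (S N) + / 2)).
  + apply Rplus_le_compat_r, Rmult_le_compat_l; lra.
  + right. field. lra.
Qed.

(** Since [remainder] vanishes at 0, each further level costs at most one factor [2 * PI / 3]. *)
Lemma lim_remainder (z : nat -> R) (Hz : zeta_values z) (p : nat) :
  is_lim_seq (fun N => remainder z (S p) N (2 * PI / 3)) 0.
Proof.
pose proof PI_RGT_0 as Hpi.
destruct (remainder_1_bound z Hz) as [A [B HE]].
set (b := fun N : nat => (/ 9) ^ N * (2 * PI / 3)
  + (B * (2 * PI / 3) + 2 * A) / (INR (S N) + / 2)).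
assert (HEp : forall N x, 0 <= x <= 2 * PI / 3 ->
  Rabs (remainder z (S p) N x) <= b N * (2 * PI / 3) ^ p).
{ intros N. induction p as [|p IH]; intros x Hx.
  - rewrite pow_O, Rmult_1_r. now apply HE.
  - rewrite <- (Rminus_0_r (remainder z (S (S p)) N x)), <- (remainder_0 z (S p) N).
    eapply Rle_trans; [apply (bound_of_derive _ (remainder z (S p) N) (b N * (2 * PI / 3) ^ p))|].
    + lra.
    + intros t Ht. split; [apply is_derive_remainder|apply IH; lra].
    + simpl pow. rewrite (Rmult_comm (2 * PI / 3)), <- Rmult_assoc.
      apply Rmult_le_compat_l; [|lra].
      eapply Rle_trans; [apply Rabs_pos|apply (IH 0); lra]. }
apply (lim_of_bound _ (fun N => b N * (2 * PI / 3) ^ p)).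
- intros N. rewrite Rminus_0_r. apply HEp. lra.
- replace (Finite 0) with (Rbar_mult (0 * (2 * PI / 3) + 0) ((2 * PI / 3) ^ p))
    by (simpl; f_equal; ring).
  apply is_lim_seq_scal_r.
  apply is_lim_seq_plus'; [|apply lim_div_half_integer].
  apply (is_lim_seq_scal_r _ (2 * PI / 3) 0), is_lim_seq_geom.
  rewrite Rabs_pos_eq; lra.
Qed.

(** * The identity over the reals *)

Lemma cos_multiple_third (k : nat) :
  cos (INR (3 * k) * (2 * PI / 3)) = 1 /\
  cos (INR (3 * k + 1) * (2 * PI / 3)) = - / 2 /\
  cos (INR (3 * k + 2) * (2 * PI / 3)) = - / 2.
Proof.
rewrite !plus_INR, mult_INR.
replace (INR 3 * INR k * (2 * PI / 3)) with (0 + 2 * INR k * PI) by (simpl; field).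
replace ((INR 3 * INR k + INR 1) * (2 * PI / 3)) with (2 * (PI / 3) + 2 * INR k * PI)
  by (simpl; field).
replace ((INR 3 * INR k + INR 2) * (2 * PI / 3)) with (PI / 3 + PI + 2 * INR k * PI)
  by (simpl; field).
rewrite !cos_period, cos_0, cos_2a_cos, neg_cos, cos_PI3. lra.
Qed.

(** The indices up to [3 * N + 2] stand for the integers 1 to [3N + 3], that is [N + 1] full
    periods. Writing the weight as -1/2 everywhere plus 3/2 on multiples of 3 gives the two sums. *)
Lemma sum_cos_third (s N : nat) :
  sum_n (fun n => cos (INR (S n) * (2 * PI / 3)) / INR (S n) ^ s) (3 * N + 2)
  = - / 2 * sum_n (fun n => / INR (S n) ^ s) (3 * N + 2)
    + 3 / 2 * / 3 ^ s * sum_n (fun n => / INR (S n) ^ s) N.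
Proof.
assert (step : forall k, INR (3 * k + 3) ^ s = 3 ^ s * INR (S k) ^ s).
{ intros k. rewrite <- Rpow_mult_distr. f_equal. rewrite S_INR, plus_INR, mult_INR. simpl. ring. }
assert (H3 : 3 ^ s <> 0) by (apply pow_nonzero; lra).
assert (HS : forall k, INR (S k) ^ s <> 0) by (intros k; apply pow_nonzero, not_0_INR; lia).
assert (HC : forall k, cos (INR (3 * k + 3) * (2 * PI / 3)) = 1).
{ intros k. replace (3 * k + 3)%nat with (3 * S k)%nat by lia. apply cos_multiple_third. }
induction N as [|N IH].
- replace (3 * 0 + 2)%nat with 2%nat by lia. rewrite !sum_n_S, !sum_O.
  destruct (cos_multiple_third 0) as [_ [C1 C2]]. pose proof (HC 0%nat) as C3.
  pose proof (step 0%nat) as P3.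
  change (3 * 0 + 1)%nat with 1%nat in C1. change (3 * 0 + 2)%nat with 2%nat in C2.
  change (3 * 0 + 3)%nat with 3%nat in C3, P3.
  rewrite C1, C2, C3, P3.
  pose proof (HS 0%nat). pose proof (HS 1%nat).
  generalize dependent (INR 1 ^ s). generalize dependent (INR 2 ^ s). intros.
  real_eq. field.
  repeat split; trivial.
- replace (3 * S N + 2)%nat with (S (S (S (3 * N + 2)))) by lia.
  rewrite !sum_n_S, IH.
  destruct (cos_multiple_third (S N)) as [_ [C1 C2]]. pose proof (HC (S N)) as C3.
  pose proof (step (S N)) as P3.
  replace (S (S (3 * N + 2))) with (3 * S N + 1)%nat by lia.
  replace (S (3 * S N + 1)) with (3 * S N + 2)%nat by lia.
  replace (S (3 * S N + 2)) with (3 * S N + 3)%nat by lia.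
  rewrite C1, C2, C3, P3.
  assert (K1 : INR (3 * S N + 1) ^ s <> 0) by (apply pow_nonzero, not_0_INR; lia).
  assert (K2 : INR (3 * S N + 2) ^ s <> 0) by (apply pow_nonzero, not_0_INR; lia).
  specialize (HS (S N)).
  generalize dependent (INR (3 * S N + 1) ^ s). generalize dependent (INR (3 * S N + 2) ^ s).
  generalize dependent (INR (S (S N)) ^ s). intros.
  real_eq. field.
  repeat split; trivial.
Qed.

Lemma is_series_cos_third (z : nat -> R) (Hz : zeta_values z) (s : nat) : (2 <= s)%nat ->
  is_series (fun n => cos (INR (S n) * (2 * PI / 3)) / INR (S n) ^ s)
    ((3 / 3 ^ s - 1) / 2 * z s).
Proof.
intros Hs. pose proof (proj2 Hz s Hs) as Hzs.
assert (Hex : ex_series (fun n => cos (INR (S n) * (2 * PI / 3)) / INR (S n) ^ s)).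
{ apply (ex_series_le (K := R_AbsRing) (V := R_CompleteNormedModule) _ (fun n => / INR (S n) ^ s)).
  - intros n. unfold norm; simpl norm. unfold abs; simpl abs.
    assert (0 < / INR (S n) ^ s) by (apply Rinv_0_lt_compat, pow_lt, lt_0_INR; lia).
    change (Rabs (cos (INR (S n) * (2 * PI / 3)) / INR (S n) ^ s) <= / INR (S n) ^ s).
    unfold Rdiv at 1. rewrite Rabs_mult, (Rabs_pos_eq (/ _)) by lra.
    rewrite <- (Rmult_1_l (/ INR (S n) ^ s)) at 2.
    apply Rmult_le_compat_r; [lra|]. apply Rabs_le, COS_bound.
  - now exists (z s). }
destruct Hex as [c Hc].
replace ((3 / 3 ^ s - 1) / 2 * z s) with c; trivial.
(* Convergence is already known by comparison, so the sum can be read off along full periods. *)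
assert (Hsub : forall u (l : R), is_series u l -> is_lim_seq (fun N => sum_n u (3 * N + 2)) l).
{ intros u l Hu. apply (is_lim_seq_subseq (sum_n u) l (fun N => (3 * N + 2)%nat)); trivial.
  apply eventually_subseq. intros n. lia. }
pose proof (Hsub _ _ Hc) as L1.
apply (is_lim_seq_ext _ _ _ (sum_cos_third s)) in L1.
assert (L2 : is_lim_seq (fun N => - / 2 * sum_n (fun n => / INR (S n) ^ s) (3 * N + 2)
    + 3 / 2 * / 3 ^ s * sum_n (fun n => / INR (S n) ^ s) N)
  (- / 2 * z s + 3 / 2 * / 3 ^ s * z s)).
{ apply is_lim_seq_plus'; apply (is_lim_seq_scal_l _ _ (z s)).
  - now apply Hsub.
  - exact Hzs. }
apply is_lim_seq_unique in L1. apply is_lim_seq_unique in L2.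
rewrite L1 in L2. injection L2 as L2.
change (@eq R c ((3 / 3 ^ s - 1) / 2 * z s)). rewrite L2. field. apply pow_nonzero. lra.
Qed.

Lemma kap_odd (r : nat) (y : R) : kap (S (2 * r)) y = (-1) ^ r * cos y.
Proof.
rewrite kap_S, mult_INR. induction r as [|r IH].
- simpl. rewrite Rmult_1_l. f_equal. ring.
- rewrite (S_INR r).
  replace (y - INR 2 * (INR r + 1) * (PI / 2)) with
    (- (PI - (y - INR 2 * INR r * (PI / 2)))) by (simpl; field).
  rewrite cos_neg, Rtrigo_facts.cos_pi_minus, IH. simpl. ring.
Qed.

Lemma kap_even_0 (i : nat) : kap (2 * i) 0 = 0.
Proof.
unfold kap. rewrite mult_INR.
replace (0 - INR 2 * INR i * (PI / 2)) with (- (INR i * PI)) by (simpl; field).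
rewrite sin_neg, sin_nat_PI. ring.
Qed.

Lemma is_lim_seq_sum_n (u : nat -> nat -> R) (l : nat -> R) (p : nat) :
  (forall j, is_lim_seq (u j) (l j)) ->
  is_lim_seq (fun N => sum_n (fun j => u j N) p) (sum_n l p).
Proof.
intros H. induction p as [|p IH].
- rewrite sum_O. apply (is_lim_seq_ext (u 0%nat)); trivial.
  intros n. now rewrite sum_O.
- rewrite sum_n_S. apply (is_lim_seq_ext (fun N => sum_n (fun j => u j N) p + u (S p) N)).
  + intros n. now rewrite sum_n_S.
  + now apply is_lim_seq_plus'.
Qed.

Lemma lim_trig_part_0 (z : nat -> R) (Hz : zeta_values z) (j : nat) :
  is_lim_seq (fun N => trig_part j N 0) (INR j * kap (S j) 0 * z (S j)).
Proof.
apply (is_lim_seq_ext (fun N => INR j * kap (S j) 0 * sum_n (fun n => / INR (S n) ^ S j) N)).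
{ intros N. rewrite <- sum_n_scal. apply sum_n_eq. intros n. rewrite Rmult_0_r.
  unfold Rdiv. ring. }
(* At [j = 0] the limit mentions [z 1], the unconstrained value at the pole; the factor [INR 0]
   removes it. *)
destruct j as [|j].
- simpl INR at 1. apply (is_lim_seq_ext (fun _ => 0)).
  + intros N. simpl (INR 0). now rewrite !Rmult_0_l.
  + simpl (INR 0). rewrite !Rmult_0_l. apply is_lim_seq_const.
- apply (is_lim_seq_scal_l _ _ (z (S (S j)))). apply (proj2 Hz). lia.
Qed.

Lemma sum_n_add (a b : nat -> R) (N : nat) :
  sum_n (fun n => a n + b n) N = sum_n a N + sum_n b N.
Proof. exact (sum_n_plus a b N). Qed.

Lemma sum_n_even (f : nat -> R) (r : nat) :
  (forall i, f (S (2 * i)) = 0) -> sum_n f (2 * r) = sum_n (fun i => f (2 * i)%nat) r.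
Proof.
intros H. induction r as [|r IH].
- simpl Nat.mul. now rewrite !sum_O.
- replace (2 * S r)%nat with (S (S (2 * r))) by lia.
  rewrite !sum_n_S, IH, H. replace (2 * S r)%nat with (S (S (2 * r))) by lia. ring_R.
Qed.

Lemma sum_n_left (f : nat -> R) (r : nat) : sum_n f (S r) = f 0%nat + sum_n (fun k => f (S k)) r.
Proof.
induction r as [|r IH]; [now rewrite sum_n_S, !sum_O|].
rewrite sum_n_S, IH, sum_n_S. ring_R.
Qed.

Lemma sum_n_rev (f : nat -> R) (r : nat) : sum_n f r = sum_n (fun k => f (r - k)%nat) r.
Proof.
induction r as [|r IH]; [now rewrite !sum_O|].
rewrite sum_n_S, sum_n_left, IH. simpl Nat.sub. ring_R.
Qed.

Lemma sum_n_m_1 (f : nat -> R) (r : nat) :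
  sum_n f (S (S r)) = f 0%nat + sum_n_m f 1 (S r) + f (S (S r)).
Proof.
rewrite sum_n_S, sum_n_left.
replace (sum_n_m f 1 (S r)) with (sum_n (fun k => f (S k)) r); [reflexivity|].
exact (sum_n_m_S f 0 r).
Qed.

Lemma sum_n_m_scal (c : R) (a : nat -> R) (p q : nat) :
  sum_n_m (fun k => c * a k) p q = c * sum_n_m a p q.
Proof. exact (sum_n_m_mult_l (K := R_Ring) c a p q). Qed.

(** The sine series [C_{2r}] enters with [- (2r-1) x] from the first summand and [+ (2r-1) x] from
    the second, and cancels. The new weights come from [(2r-1) / m! + 1 / (m-1)! = (2r-1+m) / m!],
    with [m = 2r+2k] in the zeta part and [m = 2r-j] in the polynomial. *)
Lemma remainder_combination (z : nat -> R) (r N : nat) (x : R) : (1 <= r)%nat -> x <> 0 ->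
  INR (2 * r - 1) * remainder z (2 * r) N x + x * remainder z (2 * r - 1) N x
  = (INR (2 * r - 1) * INR (2 * r) * (-1) ^ r
       * sum_n (fun n => cos (INR (S n) * x) / INR (S n) ^ (2 * r + 1)) N
     + x ^ 2 * (-1) ^ r
       * sum_n (fun n => cos (INR (S n) * x) / INR (S n) ^ (2 * r - 1)) N)
    + 2 * x ^ (2 * r) *
      sum_n (fun k => INR (fact (2 * k)) * INR (4 * r + 2 * k - 1) / INR (fact (2 * r + 2 * k))
        * (z (2 * k)%nat * (x / (2 * PI)) ^ (2 * k))) N
    - sum_n (fun j => trig_part j N 0 *
        (INR (4 * r - 1 - j) * (x ^ (2 * r - j) / INR (fact (2 * r - j))))) (2 * r).
Proof.
intros Hr Hx. pose proof PI_RGT_0 as Hpi.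
assert (H1 : INR (2 * r - 1) = INR (2 * r) - 1) by (rewrite minus_INR by lia; reflexivity).
assert (HW : INR (2 * r - 1) * trig_part (2 * r) N x + x * trig_part (2 * r - 1) N x
  = INR (2 * r - 1) * INR (2 * r) * (-1) ^ r
       * sum_n (fun n => cos (INR (S n) * x) / INR (S n) ^ (2 * r + 1)) N
     + x ^ 2 * (-1) ^ r
       * sum_n (fun n => cos (INR (S n) * x) / INR (S n) ^ (2 * r - 1)) N).
{ unfold trig_part. rewrite <- !sum_n_scal, <- !sum_n_add. apply sum_n_eq. intros n.
  replace (S (2 * r - 1)) with (2 * r)%nat by lia.
  replace (2 * r + 1)%nat with (S (2 * r)) by lia.
  rewrite kap_odd.
  replace (kap (2 * r - 1) (INR (S n) * x)) with (- ((-1) ^ r * cos (INR (S n) * x))).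
  - unfold Rdiv. ring.
  - destruct r as [|r]; [lia|]. replace (2 * S r - 1)%nat with (S (2 * r)) by lia.
    rewrite kap_odd. simpl. ring. }
assert (HQ : INR (2 * r - 1) * zeta_part z (2 * r) N x + x * zeta_part z (2 * r - 1) N x
  = - 2 * x ^ (2 * r) *
      sum_n (fun k => INR (fact (2 * k)) * INR (4 * r + 2 * k - 1) / INR (fact (2 * r + 2 * k))
        * (z (2 * k)%nat * (x / (2 * PI)) ^ (2 * k))) N).
{ unfold zeta_part. rewrite <- !sum_n_scal, <- !sum_n_add. apply sum_n_eq. intros k.
  replace (2 * r + 2 * k)%nat with (S (2 * k + (2 * r - 1))) by lia.
  replace (2 * k + 2 * r)%nat with (S (2 * k + (2 * r - 1))) by lia.
  replace (x ^ (2 * r)) with (x * x ^ (2 * r - 1)) by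
    (replace (2 * r)%nat with (S (2 * r - 1)) at 2 by lia; reflexivity).
  rewrite fact_simpl, mult_INR.
  replace (INR (4 * r + 2 * k - 1)) with (INR (2 * r - 1) + INR (S (2 * k + (2 * r - 1))))
    by (rewrite <- plus_INR; f_equal; lia).
  pose proof (INR_fact_neq_0 (2 * k + (2 * r - 1))) as F1.
  pose proof (not_0_INR (S (2 * k + (2 * r - 1))) ltac:(lia)) as F2.
  generalize dependent (INR (fact (2 * k + (2 * r - 1)))).
  generalize dependent (INR (S (2 * k + (2 * r - 1)))). intros a Ha b Hb.
  replace ((x / (2 * PI)) ^ (2 * k)) with (x ^ (2 * k) / (2 * PI) ^ (2 * k))
    by (unfold Rdiv; rewrite (Rpow_mult_distr x), pow_inv; reflexivity).
  rewrite <- tech_pow_Rmult, pow_add. field.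
  repeat split; trivial. apply pow_nonzero; lra. }
assert (HP : INR (2 * r - 1) * taylor_part (2 * r) N x + x * taylor_part (2 * r - 1) N x
  = sum_n (fun j => trig_part j N 0 *
        (INR (4 * r - 1 - j) * (x ^ (2 * r - j) / INR (fact (2 * r - j))))) (2 * r)).
(* The index [j = 2r] occurs only in the first sum. Its weight [2r - 1] still agrees with
   [4r - 1 - j], so it is split off before the other terms are merged. *)
{ unfold taylor_part. replace (2 * r)%nat with (S (2 * r - 1)) by lia.
  set (q := (2 * r - 1)%nat) in *. replace (S q - 1)%nat with q by lia.
  rewrite !sum_n_S. rewrite !Nat.sub_diag.
  replace (4 * r - 1 - S q)%nat with q by lia.
  replace (sum_n (fun j => trig_part j N 0 * (INR (4 * r - 1 - j)
     * (x ^ (S q - j) / INR (fact (S q - j))))) q) with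
   (INR q * sum_n (fun j => trig_part j N 0 * (x ^ (S q - j) / INR (fact (S q - j)))) q
    + x * sum_n (fun j => trig_part j N 0 * (x ^ (q - j) / INR (fact (q - j)))) q);
   [ring_R|].
  rewrite <- !sum_n_scal, <- sum_n_add. apply (sum_n_ext_loc (G := R_AbelianMonoid)).
  intros j Hj.
  replace (4 * r - 1 - j)%nat with (q + S (q - j))%nat by lia.
  replace (S q - j)%nat with (S (q - j)) by lia.
  rewrite plus_INR, fact_simpl, mult_INR.
  pose proof (INR_fact_neq_0 (q - j)) as F1.
  pose proof (not_0_INR (S (q - j)) ltac:(lia)) as F2.
  generalize dependent (INR (fact (q - j))).
  generalize dependent (INR (S (q - j))). intros a Ha b Hb. simpl pow.
  real_eq.
  field. now split. }
unfold remainder.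
transitivity ((INR (2 * r - 1) * trig_part (2 * r) N x + x * trig_part (2 * r - 1) N x)
  - (INR (2 * r - 1) * zeta_part z (2 * r) N x + x * zeta_part z (2 * r - 1) N x)
  - (INR (2 * r - 1) * taylor_part (2 * r) N x + x * taylor_part (2 * r - 1) N x)); [ring|].
rewrite HW, HQ, HP. ring.
Qed.

(** Here [rho = r], [a = 2r - 1], [Y = 3^(2r-2)], [s = (-1)^r], [X = (2 PI / 3)^(2r)], and [z1],
    [z0] are the zeta values at [2r + 1] and [2r - 1]. The factor after [s * X] is the sum of the
    infinite series, already solved for in terms of [z1], so only a rational identity modulo
    [s * s = 1] is left. *)
Lemma zeta_odd_algebra (rho a Y s X z1 z0 S1 : R) :
  rho <> 0 -> a <> 0 -> 1 <= Y -> s * s = 1 -> X <> 0 ->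
  z1 = - (2 * PI ^ 2 * (Y - 1) / (rho * a * (3 * (3 * (3 * Y)) - 1))) * z0
    + 2 * (3 * (3 * Y)) / (rho * a * (3 * (3 * (3 * Y)) - 1))
      * (S1 + s * X * ((0 - (a * (2 * rho) * s * ((3 / (3 * (3 * (3 * Y))) - 1) / 2 * z1)
           + (2 * PI / 3) ^ 2 * s * ((3 / (3 * Y) - 1) / 2 * z0))
           + s * (2 * rho * a * z1 - 2 * S1)) * / (2 * X))).
Proof.
intros Hr Ha HY Hs HX.
match goal with |- context [S1 + ?u] => replace u with
  (s * s * ((0 - (a * (2 * rho) * ((3 / (3 * (3 * (3 * Y))) - 1) / 2 * z1)
           + (2 * PI / 3) ^ 2 * ((3 / (3 * Y) - 1) / 2 * z0))
           + (2 * rho * a * z1 - 2 * S1)) / 2)) by (field; repeat split; lra) end.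
rewrite Hs. field. repeat split; lra.
Qed.

Lemma zeta_odd_real (z : nat -> R) (Hz : zeta_values z) (r : nat) (Hr : (2 <= r)%nat) :
  exists T : R,
    is_series (fun k => INR (fact (2 * k)) * INR (4 * r + 2 * k - 1) / INR (fact (2 * r + 2 * k))
        * (z (2 * k)%nat / 3 ^ (2 * k))) T /\
    z (2 * r + 1)%nat =
      - (2 * PI ^ 2 * (3 ^ (2 * r - 2) - 1)
               / (INR r * INR (2 * r - 1) * (3 ^ (2 * r + 1) - 1))) * z (2 * r - 1)%nat
      + 2 * 3 ^ (2 * r) / (INR r * INR (2 * r - 1) * (3 ^ (2 * r + 1) - 1))
        * (sum_n_m (fun k => (-1) ^ (k - 1) * (INR (r - k) * INR (2 * r + 2 * k - 1)
                    / INR (fact (2 * k))) * (2 * PI / 3) ^ (2 * k)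
                  * z (2 * r + 1 - 2 * k)%nat) 1 (r - 1)
           + (-1) ^ r * (2 * PI / 3) ^ (2 * r) * T).
Proof.
pose proof PI_RGT_0 as Hpi.
set (x := 2 * PI / 3). assert (Hx : x <> 0) by (unfold x; lra).
set (t := fun k => INR (fact (2 * k)) * INR (4 * r + 2 * k - 1) / INR (fact (2 * r + 2 * k))
        * (z (2 * k)%nat / 3 ^ (2 * k))).
set (S1 := sum_n_m _ 1 (r - 1)).
set (om := INR (2 * r - 1) * INR (2 * r) * (-1) ^ r
    * ((3 / 3 ^ (2 * r + 1) - 1) / 2 * z (2 * r + 1)%nat)
  + x ^ 2 * (-1) ^ r * ((3 / 3 ^ (2 * r - 1) - 1) / 2 * z (2 * r - 1)%nat)).
set (f := fun j => INR j * kap (S j) 0 * z (S j)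
  * (INR (4 * r - 1 - j) * (x ^ (2 * r - j) / INR (fact (2 * r - j))))).
assert (Lom : is_lim_seq (fun N => INR (2 * r - 1) * INR (2 * r) * (-1) ^ r
       * sum_n (fun n => cos (INR (S n) * x) / INR (S n) ^ (2 * r + 1)) N
     + x ^ 2 * (-1) ^ r
       * sum_n (fun n => cos (INR (S n) * x) / INR (S n) ^ (2 * r - 1)) N) om).
{ apply is_lim_seq_plus'.
  - apply (is_lim_seq_scal_l _ _ ((3 / 3 ^ (2 * r + 1) - 1) / 2 * z (2 * r + 1)%nat)).
    apply is_series_cos_third; trivial. lia.
  - apply (is_lim_seq_scal_l _ _ ((3 / 3 ^ (2 * r - 1) - 1) / 2 * z (2 * r - 1)%nat)).
    apply is_series_cos_third; trivial. lia. }
assert (Lpi : is_lim_seq (fun N => sum_n (fun j => trig_part j N 0 *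
        (INR (4 * r - 1 - j) * (x ^ (2 * r - j) / INR (fact (2 * r - j))))) (2 * r))
   (sum_n f (2 * r))).
{ apply (is_lim_seq_sum_n (fun j N => trig_part j N 0 *
        (INR (4 * r - 1 - j) * (x ^ (2 * r - j) / INR (fact (2 * r - j)))))).
  intros j. apply (is_lim_seq_scal_r _ _ (INR j * kap (S j) 0 * z (S j))).
  now apply lim_trig_part_0. }
assert (LE : is_lim_seq (fun N => INR (2 * r - 1) * remainder z (2 * r) N x
    + x * remainder z (2 * r - 1) N x) 0).
{ replace (Finite 0) with (Finite (INR (2 * r - 1) * 0 + x * 0)) by (f_equal; ring).
  apply is_lim_seq_plus'; apply (is_lim_seq_scal_l _ _ 0).
  - replace (2 * r)%nat with (S (2 * r - 1)) by lia. now apply lim_remainder.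
  - replace (2 * r - 1)%nat with (S (2 * r - 2)) by lia. now apply lim_remainder. }
assert (Hx2 : 2 * x ^ (2 * r) <> 0) by (apply Rmult_integral_contrapositive_currified;
  [lra|now apply pow_nonzero]).
(* The value forced by letting [N] tend to infinity in [remainder_combination]: all other terms
   converge, so the infinite series converges as well. *)
set (T := (0 - om + sum_n f (2 * r)) * / (2 * x ^ (2 * r))).
exists T. split.
- change (is_lim_seq (sum_n t) T).
  pose proof (is_lim_seq_plus' _ _ _ _ (is_lim_seq_minus' _ _ _ _ LE Lom) Lpi) as L.
  apply (is_lim_seq_scal_r _ (/ (2 * x ^ (2 * r)))) in L.
  eapply is_lim_seq_ext; [|exact L]. intros N. cbv beta.
  rewrite remainder_combination by (trivial; lia).
  replace (sum_n (fun k => INR (fact (2 * k)) * INR (4 * r + 2 * k - 1) / INR (fact (2 * r + 2 * k))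
        * (z (2 * k)%nat * (x / (2 * PI)) ^ (2 * k))) N) with (sum_n t N).
  + real_eq. field.
    now apply pow_nonzero.
  + apply sum_n_eq. intros k. unfold t.
    replace (x / (2 * PI)) with (/ 3) by (unfold x; field; lra).
    now rewrite pow_inv.
(* Odd [j] drop out because [kap] of even index vanishes at 0. Reversal puts [j = 2 (r - k)]:
   [k = 0] gives the [zeta(2r+1)] term, the middle range gives [S1], and [k = r] carries the factor
   [j = 0], which discards [z 1]. *)
- assert (Hpi2 : sum_n f (2 * r) = (-1) ^ r *
    (2 * INR r * INR (2 * r - 1) * z (2 * r + 1)%nat - 2 * S1)).
  { rewrite sum_n_even.
    2:{ intros i. unfold f. replace (S (S (2 * i))) with (2 * S i)%nat by lia.
        rewrite kap_even_0. ring. }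
    rewrite sum_n_rev.
    destruct r as [|[|r]]; [lia|lia|].
    rewrite sum_n_m_1.
    replace (S (S r) - 1)%nat with (S r) in S1 by lia.
    match goal with |- @eq _ (?a + ?b + ?c) _ =>
      replace c with 0; [replace b with (- 2 * (-1) ^ S (S r) * S1)|] end.
    - rewrite Nat.sub_0_r. unfold f. rewrite kap_odd, cos_0.
      replace (4 * S (S r) - 1 - 2 * S (S r))%nat with (2 * S (S r) - 1)%nat by lia.
      rewrite Nat.sub_diag. replace (2 * S (S r) + 1)%nat with (S (2 * S (S r))) by lia.
      rewrite (mult_INR 2). change (INR (fact 0)) with 1. change (INR 2) with 2.
      change (x ^ 0) with 1.
      real_eq. field.
    - unfold S1.
      rewrite <- sum_n_m_scal. apply sum_n_m_ext_loc. intros k Hk.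
      unfold f. rewrite kap_odd, cos_0.
      real_eq.
      replace (2 * S (S r) - 2 * (S (S r) - k))%nat with (2 * k)%nat by lia.
      replace (4 * S (S r) - 1 - 2 * (S (S r) - k))%nat with (2 * S (S r) + 2 * k - 1)%nat by lia.
      replace (2 * S (S r) + 1 - 2 * k)%nat with (S (2 * (S (S r) - k))) by lia.
      fold x. rewrite (mult_INR 2). change (INR 2) with 2.
      replace (- 2 * (-1) ^ S (S r)) with (2 * ((-1) ^ (S (S r) - k) * (-1) ^ (k + 1) * -1 * -1)).
      2:{ rewrite <- pow_add. replace (S (S r) - k + (k + 1))%nat with (S (S (S r))) by lia.
          simpl. ring. }
      replace ((-1) ^ (k + 1)) with ((-1) ^ (k - 1)) by
        (replace (k + 1)%nat with (S (S (k - 1))) by lia; simpl; ring).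
      assert (Hsq : (-1) ^ (k - 1) * (-1) ^ (k - 1) = 1).
      { rewrite <- Rpow_mult_distr. replace (-1 * -1) with 1 by ring. apply pow1. }
      transitivity (2 * (-1) ^ (S (S r) - k) * ((-1) ^ (k - 1) * (-1) ^ (k - 1)) *
        (INR (S (S r) - k) * INR (2 * S (S r) + 2 * k - 1)
                    / INR (fact (2 * k))) * x ^ (2 * k)
                  * z (S (2 * (S (S r) - k)))); [unfold Rdiv; ring|].
      rewrite Hsq. unfold Rdiv. ring.
    - rewrite Nat.sub_diag. unfold f. simpl (INR (2 * 0)). ring. }
  assert (Hsq : (-1) ^ r * (-1) ^ r = 1).
  { rewrite <- Rpow_mult_distr. replace (-1 * -1) with 1 by ring. apply pow1. }
  unfold T. rewrite Hpi2. unfold om.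
  replace (2 * r + 1)%nat with (S (S (S (2 * r - 2)))) by lia.
  replace (3 ^ (2 * r)) with (3 * (3 * 3 ^ (2 * r - 2))) by
    (replace (2 * r)%nat with (S (S (2 * r - 2))) at 2 by lia; reflexivity).
  replace (3 ^ (2 * r - 1)) with (3 * 3 ^ (2 * r - 2)) by
    (replace (2 * r - 1)%nat with (S (2 * r - 2)) by lia; reflexivity).
  change (3 ^ S (S (S (2 * r - 2)))) with (3 * (3 * (3 * 3 ^ (2 * r - 2)))).
  assert (HY : 1 <= 3 ^ (2 * r - 2)) by (apply pow_R1_Rle; lra).
  assert (Hr0 : INR r <> 0) by (apply not_0_INR; lia).
  assert (Hr1 : INR (2 * r - 1) <> 0) by (apply not_0_INR; lia).
  rewrite (mult_INR 2). change (INR 2) with 2. unfold x at 2.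
  now apply zeta_odd_algebra; try apply pow_nonzero.
Qed.

(** * Real-analytic functions *)

Lemma CV_radius_gt (a : nat -> R) (eps x : R) :
  (forall y, 0 < y < eps -> ex_pseries a y) -> Rabs x < eps ->
  Rbar_lt (Rabs x) (CV_radius a).
Proof.
intros Ha Hx. pose proof (Rabs_pos x) as Hp.
apply Rbar_not_le_lt. intros H.
apply (CV_disk_outside a ((Rabs x + eps) / 2)).
- rewrite (Rabs_pos_eq ((Rabs x + eps) / 2)) by lra.
  apply (Rbar_le_lt_trans _ _ _ H). simpl. lra.
- apply (ex_series_lim_0 (fun n => a n * ((Rabs x + eps) / 2) ^ n)).
  destruct (Ha ((Rabs x + eps) / 2)) as [l Hl]; [lra|].
  exists l. apply is_pseries_R, Hl.
Qed.

(** Continuity at 0 kills the constant term; dividing by [y] shifts the coefficients and the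
    argument repeats. The one-sided form is what is available at the supremum in
    [real_analytic_zero]. *)
Lemma pseries_zero_right (n : nat) : forall (a : nat -> R) (eps : R), 0 < eps ->
  (forall y, 0 < y < eps -> is_pseries a y 0) -> a n = 0.
Proof.
assert (base : forall (a : nat -> R) (eps : R), 0 < eps ->
  (forall y, 0 < y < eps -> is_pseries a y 0) -> a 0%nat = 0).
{ intros a eps He Ha.
  assert (L : is_lim_seq (fun k => PSeries a (eps / (INR (S k) + / 2))) (PSeries a 0)).
  { apply (is_lim_seq_continuous (PSeries a)).
    - apply PSeries_continuity. apply (CV_radius_gt a eps).
      + intros y Hy. exists 0. now apply Ha.
      + rewrite Rabs_R0. trivial.
    - apply lim_div_half_integer. }
  apply (is_lim_seq_ext _ (fun _ => 0)) in L.
  - apply is_lim_seq_unique in L. rewrite Lim_seq_const in L.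
    injection L as L. rewrite PSeries_0 in L. now symmetry.
  - intros k. apply is_pseries_unique, Ha.
    assert (1 < INR (S k) + / 2) by (rewrite S_INR; pose proof (pos_INR k); lra).
    split; [apply Rdiv_lt_0_compat; lra|]. apply Rcomplements.Rlt_div_l; nra. }
induction n as [|n IH]; intros a eps He Ha; [now apply (base a eps)|].
apply (IH (PS_decr_1 a) eps He). intros y Hy.
pose proof (is_pseries_decr_1 a y (/ y) 0) as H.
rewrite (base a eps He Ha) in H.
replace 0 with (scal (/ y) (plus 0 (opp 0))).
- apply H; [|now apply Ha]. unfold mult, one; simpl. field. lra.
- unfold scal, plus, opp; simpl. unfold mult; simpl. ring.
Qed.

Definition real_analytic (f : R -> R) (x : R) : Prop :=
  exists (a : nat -> R) (eps : R), 0 < eps /\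
    forall y, Rabs y < eps -> is_pseries a y (f (x + y)).

(** At the supremum of the points where [f] is nonzero, [f] vanishes to the right, so its expansion
    there is zero and [f] vanishes a little to the left too, a contradiction. *)
Lemma real_analytic_zero (f : R -> R) (lo hi : R) :
  (forall x, lo < x -> real_analytic f x) -> (forall x, hi < x -> f x = 0) ->
  forall x, lo < x -> f x = 0.
Proof.
intros Hf Hhi x Hx. destruct (Req_dec (f x) 0) as [H0|H0]; trivial. exfalso.
destruct (completeness (fun t => f t <> 0)) as [s [Hub Hlub]].
- exists hi. intros t Ht. destruct (Rle_lt_dec t hi) as [H|H]; trivial.
  destruct Ht. now apply Hhi.
- now exists x.
- assert (Hs : forall t, s < t -> f t = 0).
  { intros t Ht. destruct (Req_dec (f t) 0) as [H|H]; trivial.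
    specialize (Hub t H). lra. }
  assert (Hxs : x <= s) by now apply Hub.
  destruct (Hf s ltac:(lra)) as [a [eps [He Ha]]].
  assert (Hz : forall n, a n = 0).
  { intros n. apply (pseries_zero_right n a eps He). intros y Hy.
    rewrite <- (Hs (s + y)) by lra. apply Ha. rewrite Rabs_pos_eq; lra. }
  assert (H : s <= s - eps / 2); [|lra].
  apply Hlub. intros t Ht. destruct (Rle_lt_dec t (s - eps / 2)) as [H|H]; trivial.
  exfalso. apply Ht. destruct (Rle_lt_dec t s) as [H'|H']; [|now apply Hs].
  replace t with (s + (t - s)) by ring.
  rewrite <- (is_pseries_unique _ _ _ (Ha (t - s) ltac:(apply Rabs_lt_between; lra))).
  unfold PSeries. rewrite (Series_ext _ (fun _ => 0)) by (intros n; rewrite Hz; ring).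
  apply is_series_unique, is_series_R0.
Qed.

Lemma real_analytic_minus (f g : R -> R) (x : R) :
  real_analytic f x -> real_analytic g x -> real_analytic (fun t => f t - g t) x.
Proof.
intros [a [e [He Ha]]] [b [e' [He' Hb]]].
exists (PS_minus a b), (Rmin e e'). split; [now apply Rmin_glb_lt|].
intros y Hy. apply (is_pseries_minus (K := R_AbsRing) (V := R_NormedModule)).
- apply Ha. eapply Rlt_le_trans; [exact Hy|apply Rmin_l].
- apply Hb. eapply Rlt_le_trans; [exact Hy|apply Rmin_r].
Qed.

Lemma real_analytic_mult (f g : R -> R) (x : R) :
  real_analytic f x -> real_analytic g x -> real_analytic (fun t => f t * g t) x.
Proof.
intros [a [e [He Ha]]] [b [e' [He' Hb]]].
exists (PS_mult a b), (Rmin e e'). split; [now apply Rmin_glb_lt|].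
intros y Hy.
assert (H1 : Rabs y < e) by (eapply Rlt_le_trans; [exact Hy|apply Rmin_l]).
assert (H2 : Rabs y < e') by (eapply Rlt_le_trans; [exact Hy|apply Rmin_r]).
apply is_pseries_mult; auto.
- apply (CV_radius_gt _ e); trivial. intros t Ht. eexists. apply Ha.
  rewrite Rabs_pos_eq; lra.
- apply (CV_radius_gt _ e'); trivial. intros t Ht. eexists. apply Hb.
  rewrite Rabs_pos_eq; lra.
Qed.

Lemma is_pseries_exp_scal (c l y : R) :
  is_pseries (fun n => c * (l ^ n / INR (fact n))) y (c * exp (l * y)).
Proof.
apply is_pseries_R.
pose proof (proj1 (is_pseries_R _ _ _) (is_exp_Reals (l * y))) as H.
assert (H' : is_series (fun n => c * (/ INR (fact n) * (l * y) ^ n)) (c * exp (l * y)))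
  by exact (is_series_scal_l c _ _ H).
revert H'. apply is_series_congr; trivial.
intros n. rewrite Rpow_mult_distr. unfold Rdiv. ring.
Qed.

Lemma real_analytic_exp (c l x : R) : real_analytic (fun t => c * exp (l * t)) x.
Proof.
exists (fun n => c * exp (l * x) * (l ^ n / INR (fact n))), 1.
split; [lra|]. intros y _.
replace (c * exp (l * (x + y))) with (c * exp (l * x) * exp (l * y)).
- apply is_pseries_exp_scal.
- rewrite Rmult_plus_distr_l, exp_plus. ring.
Qed.

Lemma real_analytic_ext (f g : R -> R) (x : R) :
  (forall t, f t = g t) -> real_analytic f x -> real_analytic g x.
Proof.
intros E [a [e [He Ha]]]. exists a, e. split; trivial. intros y Hy. rewrite <- E. auto.
Qed.

(** * Dominated series and uniform Taylor estimates *)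

Lemma tannery (u : nat -> nat -> R) (v mu : nat -> R) :
  (forall N m, Rabs (u N m) <= mu m) -> ex_series mu ->
  (forall m, is_lim_seq (fun N => u N m) (v m)) ->
  is_lim_seq (fun N => Series (u N)) (Series v).
Proof.
intros Hu Hmu Hv.
assert (Hv' : forall m, Rabs (v m) <= mu m).
{ intros m. assert (H : Rbar_le (Rabs (v m)) (mu m)); [|exact H].
  apply (is_lim_seq_le (fun N => Rabs (u N m)) (fun _ => mu m)); trivial.
  - apply (is_lim_seq_abs _ (v m)), Hv.
  - apply is_lim_seq_const. }
assert (Eu : forall N, ex_series (u N)).
{ intros N. apply (ex_series_le (K := R_AbsRing) (V := R_CompleteNormedModule) _ mu);
    [exact (Hu N)|trivial]. }
assert (Ev : ex_series v).
{ apply (ex_series_le (K := R_AbsRing) (V := R_CompleteNormedModule) _ mu); trivial. }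
assert (tail : forall w : nat -> R, ex_series w -> (forall m, Rabs (w m) <= mu m) -> forall M,
  Rabs (Series w - sum_n w M) <= Series mu - sum_n mu M).
{ intros w Ew Hw M.
  assert (Sp : forall a : nat -> R, ex_series a ->
    Series a - sum_n a M = Series (fun k => a (S M + k)%nat)).
  { intros a Ea. rewrite (Series_incr_n a (S M)) by (trivial; lia).
    rewrite sum_n_Reals. simpl pred. ring. }
  rewrite !Sp by trivial.
  assert (E1 : ex_series (fun k => mu (S M + k)%nat)) by now apply ex_series_incr_n.
  assert (E2 : ex_series (fun k => Rabs (w (S M + k)%nat))).
  { apply (ex_series_le (K := R_AbsRing) (V := R_CompleteNormedModule) _
      (fun k => mu (S M + k)%nat)); trivial.
    intros n. unfold norm; simpl norm. unfold abs; simpl abs.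
    change (Rabs (Rabs (w (S M + n)%nat)) <= mu (S M + n)%nat). rewrite Rabs_Rabsolu. apply Hw. }
  eapply Rle_trans; [now apply Series_Rabs|]. apply Series_le; trivial.
  intros n. split; [apply Rabs_pos|apply Hw]. }
apply is_lim_seq_spec. intros eps. simpl.
destruct Hmu as [s Hs]. pose proof (is_series_unique _ _ Hs) as Es.
destruct (proj2 (is_lim_seq_spec _ _) (Hs : is_lim_seq (sum_n mu) s) (pos_div_2 (pos_div_2 eps)))
  as [M HM]. specialize (HM M (le_n M)).
pose proof (is_lim_seq_sum_n (fun m N => u N m) v M Hv) as Lf.
destruct (proj2 (is_lim_seq_spec _ _) Lf (pos_div_2 eps)) as [N0 HN0].
exists N0. intros N HN. specialize (HN0 N HN). simpl in HM, HN0.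
pose proof (tail (u N) (Eu N) (Hu N) M) as T1. pose proof (tail v Ev Hv' M) as T2.
rewrite Es in T1, T2.
apply Rabs_def2 in HM. apply Rabs_le_between in T1. apply Rabs_le_between in T2.
apply Rabs_def2 in HN0.
change (sum_n (fun m => u N m) M) with (sum_n (u N) M) in HN0.
clear Lf tail.
set (x1 := sum_n (u N) M) in *. set (x2 := sum_n v M) in *. set (x3 := sum_n mu M) in *.
clearbody x1 x2 x3. simpl in *. change R in x1, x2, x3, s.
apply Rabs_def1; lra.
Qed.

(** [tannery] is applied with the truncation order [J] as the index going to infinity. The majorant
    bounds whole Taylor polynomials, not sums of absolute values, because the pairwise cancellation
    in [eta] is estimated on the truncated polynomial as one function. *)
Lemma double_pseries (c : nat -> nat -> R) (F : nat -> R -> R) (mu : nat -> R) (rho : R) :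
  0 < rho ->
  (forall m J y, Rabs y <= rho -> Rabs (sum_n (fun j => c m j * y ^ j) J) <= mu m) ->
  ex_series mu ->
  (forall m y, Rabs y < rho -> is_pseries (c m) y (F m y)) ->
  forall y, Rabs y < rho ->
  is_pseries (fun j => Series (fun m => c m j)) y (Series (fun m => F m y)).
Proof.
intros Hrho Hc Hmu HF y Hy.
(* One coefficient times [rho ^ j] is a difference of two consecutive partial sums at [rho], hence
   at most [2 * mu m]. *)
assert (Hex : forall j, ex_series (fun m => c m j)).
{ intros j.
  apply (ex_series_le (K := R_AbsRing) (V := R_CompleteNormedModule) _
    (fun m => 2 * / rho ^ j * mu m)).
  2:{ destruct Hmu as [s Hs]. exists (2 * / rho ^ j * s).
      exact (is_series_scal_l (2 * / rho ^ j) _ _ Hs). }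
  intros m. change (Rabs (c m j) <= 2 * / rho ^ j * mu m).
  assert (Hp : 0 < rho ^ j) by now apply pow_lt.
  assert (Hr : Rabs rho <= rho) by (rewrite Rabs_pos_eq; lra).
  apply (Rmult_le_reg_r (rho ^ j)); trivial.
  replace (2 * / rho ^ j * mu m * rho ^ j) with (2 * mu m) by (field; lra).
  rewrite <- (Rabs_pos_eq (rho ^ j)) at 1 by lra. rewrite <- Rabs_mult.
  pose proof (Hc m j rho Hr) as H1.
  destruct j as [|j].
  - rewrite sum_O in H1. pose proof (Rabs_pos (c m 0%nat * rho ^ 0)). lra.
  - rewrite sum_n_S in H1. pose proof (Hc m j rho Hr) as H2.
    apply Rabs_le_between in H1. apply Rabs_le_between in H2. apply Rabs_le. lra. }
apply is_pseries_R.
change (is_lim_seq (sum_n (fun j => Series (fun m => c m j) * y ^ j)) (Series (fun m => F m y))).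
assert (Hfin : forall J, ex_series (fun m => sum_n (fun j => c m j * y ^ j) J) /\
   Series (fun m => sum_n (fun j => c m j * y ^ j) J)
   = sum_n (fun j => Series (fun m => c m j) * y ^ j) J).
{ induction J as [|J [IH1 IH2]].
  - rewrite sum_O, <- Series_scal_r.
    assert (E0 : forall m, c m 0%nat * y ^ 0 = sum_n (fun j => c m j * y ^ j) 0)
      by (intros m; now rewrite sum_O).
    split; [|symmetry; now apply Series_ext].
    apply (ex_series_ext _ _ E0). now apply (ex_series_scal_r (y ^ 0) (fun m => c m 0%nat)).
  - assert (E1 : ex_series (fun m => c m (S J) * y ^ S J))
      by now apply (ex_series_scal_r (y ^ S J) (fun m => c m (S J))).
    assert (ES : forall m, sum_n (fun j => c m j * y ^ j) J + c m (S J) * y ^ S J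
      = sum_n (fun j => c m j * y ^ j) (S J)) by (intros m; now rewrite sum_n_S).
    split.
    + apply (ex_series_ext _ _ ES).
      exact (ex_series_plus (K := R_AbsRing) (V := R_NormedModule) _ _ IH1 E1).
    + rewrite sum_n_S, <- IH2, <- Series_scal_r, <- Series_plus by trivial.
      symmetry. now apply Series_ext. }
apply (is_lim_seq_ext (fun J => Series (fun m => sum_n (fun j => c m j * y ^ j) J))).
{ intros J. apply Hfin. }
apply (tannery _ _ mu); trivial.
- intros J m. apply Hc. lra.
- intros m. exact (proj1 (is_pseries_R _ _ _) (HF m y Hy)).
Qed.

Definition exp_taylor (J : nat) (v : R) : R := sum_n (fun j => v ^ j / INR (fact j)) J.

Lemma exp_taylor_le (J : nat) (v : R) : Rabs (exp_taylor J v) <= exp (Rabs v).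
Proof.
assert (Hpos : forall j, 0 <= Rabs v ^ j / INR (fact j)).
{ intros j. apply Rcomplements.Rdiv_le_0_compat; [apply pow_le, Rabs_pos|apply INR_fact_lt_0]. }
apply Rle_trans with (exp_taylor J (Rabs v)).
- unfold exp_taylor. induction J as [|J IH].
  + rewrite !sum_O. simpl. rewrite Rabs_pos_eq; lra.
  + rewrite !sum_n_S. eapply Rle_trans; [apply Rabs_triang|].
    apply Rplus_le_compat; trivial. unfold Rdiv. rewrite Rabs_mult, RPow_abs.
    right. f_equal. apply Rabs_pos_eq, Rlt_le, Rinv_0_lt_compat, INR_fact_lt_0.
- apply (is_lim_seq_incr_compare (fun J => exp_taylor J (Rabs v))).
  + pose proof (proj1 (is_pseries_R _ _ _) (is_exp_Reals (Rabs v))) as H.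
    revert H. apply is_series_congr; trivial. intros n. unfold Rdiv. ring.
  + intros n. unfold exp_taylor. rewrite sum_n_S. specialize (Hpos (S n)). lra.
Qed.

Lemma exp_taylor_derive (J : nat) (v : R) :
  exists d, is_derive (exp_taylor J) v d /\ Rabs d <= exp (Rabs v).
Proof.
destruct J as [|J].
- exists 0. split; [|rewrite Rabs_R0; apply Rlt_le, exp_pos].
  apply (is_derive_congr (fun _ => 1) _ _ 0); trivial.
  + intros t. unfold exp_taylor. rewrite sum_O. simpl. field.
  + apply (is_derive_const (K := R_AbsRing) (V := R_NormedModule)).
- exists (exp_taylor J v). split; [|apply exp_taylor_le].
  apply (is_derive_congr (fun t => 1 + sum_n (fun j => t ^ S j / INR (fact (S j))) J) _ _
     (0 + exp_taylor J v)); [| ring |].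
  + intros t. unfold exp_taylor. rewrite sum_n_left. simpl (t ^ 0 / _). f_equal. field.
  + apply (is_derive_plus (K := R_AbsRing) (V := R_NormedModule)).
    * apply (is_derive_const (K := R_AbsRing) (V := R_NormedModule)).
    * apply is_derive_sum_n_R. intros k _. apply is_derive_pow_fact.
Qed.

Lemma exp_monotone (a b : R) : a <= b -> exp a <= exp b.
Proof. intros [H| ->]; [now apply Rlt_le, exp_increasing|apply Rle_refl]. Qed.

Lemma Rabs_mult_le (a b A B : R) : Rabs a <= A -> Rabs b <= B -> Rabs (a * b) <= A * B.
Proof.
intros Ha Hb. rewrite Rabs_mult. apply Rmult_le_compat; trivial; apply Rabs_pos.
Qed.

(** A mean value estimate: the three factors contribute [Rabs b], [sig] and [rho] to the derivative,
    while the exponentials are bounded at the ends of [[x, w]]. Uniformity in [J] is what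
    [double_pseries] requires. *)
Lemma taylor_term_bound (phi b sig y rho : R) (J : nat) (x w : R) :
  0 <= x <= w -> 0 <= sig -> Rabs y <= rho ->
  Rabs (cos (phi - b * x) * exp (- sig * x) * exp_taylor J (- x * y)
        - cos (phi - b * w) * exp (- sig * w) * exp_taylor J (- w * y))
  <= (Rabs b + sig + rho) * (exp (- sig * x) * exp (rho * w)) * (w - x).
Proof.
intros Hx Hs Hy.
set (H := fun v => cos (phi - b * v) * exp (- sig * v) * exp_taylor J (- v * y)).
rewrite Rabs_minus_sym. fold (H x) (H w).
assert (D : forall v, x <= v <= w -> exists d, is_derive H v d /\
  Rabs d <= (Rabs b + sig + rho) * (exp (- sig * x) * exp (rho * w))).
{ intros v Hv. destruct (exp_taylor_derive J (- v * y)) as [d [D1 D2]].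
  exists (b * sin (phi - b * v) * (exp (- sig * v) * exp_taylor J (- v * y))
     + - sig * cos (phi - b * v) * (exp (- sig * v) * exp_taylor J (- v * y))
     + - y * cos (phi - b * v) * (exp (- sig * v) * d)).
  split.
  - unfold H. auto_derive.
    + now exists d.
    + replace (Derive (fun x0 : R => exp_taylor J x0) (- v * y)) with d
        by (symmetry; now apply is_derive_unique).
      unfold Rminus. ring.
  - assert (Hd : forall q, Rabs q <= exp (Rabs (- v * y)) ->
      Rabs (exp (- sig * v) * q) <= exp (- sig * x) * exp (rho * w)).
    { intros q Hq. apply Rabs_mult_le.
      - rewrite Rabs_pos_eq by apply Rlt_le, exp_pos.
        apply exp_monotone. nra.
      - eapply Rle_trans; [exact Hq|]. apply exp_monotone.
        rewrite Rabs_mult, Rabs_Ropp, (Rabs_pos_eq v) by lra.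
        pose proof (Rabs_pos y). nra. }
    assert (Hb : forall q c, Rabs c <= 1 -> Rabs (q * c) <= Rabs q).
    { intros q c Hc. rewrite <- (Rmult_1_r (Rabs q)). apply Rabs_mult_le; trivial. apply Rle_refl. }
    rewrite !Rmult_plus_distr_r.
    pose proof (Hd _ (exp_taylor_le J (- v * y))) as Q1. pose proof (Hd d D2) as Q2.
    eapply Rle_trans; [apply Rabs_triang|]. apply Rplus_le_compat;
      [eapply Rle_trans; [apply Rabs_triang|]; apply Rplus_le_compat|];
      apply Rabs_mult_le; trivial;
      (eapply Rle_trans; [apply Hb, Rabs_le; first [apply SIN_bound|apply COS_bound]|]).
    + apply Rle_refl.
    + rewrite Rabs_Ropp, Rabs_pos_eq; lra.
    + now rewrite Rabs_Ropp. }
assert (D' : forall v, x <= v <= w -> is_derive H v (Derive H v) /\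
  Rabs (Derive H v) <= (Rabs b + sig + rho) * (exp (- sig * x) * exp (rho * w))).
{ intros v Hv. destruct (D v Hv) as [d [D1 D2]].
  rewrite (is_derive_unique _ _ _ D1). now split. }
now apply bound_of_derive_ab with (df := Derive H).
Qed.

(** * The alternating zeta function *)

Definition Ln (n : nat) : R := ln (INR (S n)).

(* The real part of [e^(i phi) (n+1)^(-(a + i b))]. *)
Definition dterm (phi b a : R) (n : nat) : R := cos (phi - b * Ln n) * exp (- a * Ln n).

(** The real part of [e^(i phi) z]. The angles [0] and [- (PI / 2)] return the real and imaginary
    parts, so a statement for all [phi] carries the full complex one. *)
Definition rot (phi : R) (z : C) : R := cos phi * fst z - sin phi * snd z.

(* [eta phi b a] is the real part of [e^(i phi) (1 - 2^(1-s)) zeta s] at [s = a + i b];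
   grouping the alternating series in pairs makes it absolutely convergent for [a > 0]. *)
Definition eta (phi b a : R) : R :=
  Series (fun m => dterm phi b a (2 * m) - dterm phi b a (S (2 * m))).

(** Kept as a hypothesis because it is read off from the Dirichlet series in [is_riemann_zeta], with
    no separate convergence proof. *)
Definition dirichlet_summable : Prop :=
  forall s, 1 < s -> ex_series (fun m => exp (- s * Ln m)).

Lemma Ln_pos (n : nat) : 0 <= Ln n.
Proof.
unfold Ln. rewrite <- ln_1. apply Rcomplements.ln_le; [lra|].
rewrite S_INR. pose proof (pos_INR n). lra.
Qed.

Lemma exp_Ln (n : nat) : exp (Ln n) = INR (S n).
Proof. apply exp_ln, lt_0_INR. lia. Qed.

Lemma Ln_mono (n m : nat) : (n <= m)%nat -> Ln n <= Ln m.
Proof.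
intros H. apply Rcomplements.ln_le; [apply lt_0_INR; lia|apply le_INR; lia].
Qed.

(** This is [ln (1 + 1/(n+1)) <= 1/(n+1)], with the right side as an exponential so that it merges
    with the decay factors. *)
Lemma Ln_S (n : nat) : Ln (S n) - Ln n <= exp (- Ln n).
Proof.
apply Rnot_lt_le. intros Hlt. apply exp_increasing in Hlt.
revert Hlt. apply Rle_not_lt. unfold Rminus. rewrite exp_plus, exp_Ropp, !exp_Ln.
assert (H : 0 < INR (S n)) by (apply lt_0_INR; lia).
rewrite (S_INR (S n)).
replace ((INR (S n) + 1) * / INR (S n)) with (1 + / INR (S n)) by (field; lra).
apply exp_ineq1_le.
Qed.

Lemma Ln_double (m : nat) : Ln (S (2 * m)) = ln 2 + Ln m.
Proof.
unfold Ln. rewrite <- ln_mult; [|lra|apply lt_0_INR; lia].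
f_equal. replace (S (S (2 * m))) with (2 * S m)%nat by lia. now rewrite mult_INR.
Qed.

(** With [L = Ln (2 * m)], the gap to the next logarithm is at most [exp (- L)] and at most 1. The
    radius [sig / 2] spends half of the decay, leaving [exp (- (1 + sig / 2) * L)] up to
    [exp (sig / 2)], which is summable. *)
Lemma pair_bound (phi b sig y : R) (J m : nat) : 0 < sig -> Rabs y <= sig / 2 ->
  Rabs (cos (phi - b * Ln (2 * m)) * exp (- sig * Ln (2 * m)) * exp_taylor J (- Ln (2 * m) * y)
    - cos (phi - b * Ln (S (2 * m))) * exp (- sig * Ln (S (2 * m)))
        * exp_taylor J (- Ln (S (2 * m)) * y))
  <= (Rabs b + sig + sig / 2) * exp (sig / 2) * exp (- (1 + sig / 2) * Ln m).
Proof.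
intros Hs Hy.
pose proof (Ln_pos (2 * m)) as H0. pose proof (Ln_S (2 * m)) as H1.
pose proof (Ln_mono (2 * m) (S (2 * m)) ltac:(lia)) as H2.
pose proof (Ln_mono m (2 * m) ltac:(lia)) as H3.
eapply Rle_trans; [apply (taylor_term_bound phi b sig y (sig / 2)); lra|].
rewrite !Rmult_assoc. apply Rmult_le_compat_l; [pose proof (Rabs_pos b); lra|].
apply Rle_trans with (exp (- sig * Ln (2 * m)) * (exp (sig / 2 * Ln (S (2 * m))) * exp (- Ln (2 * m)))).
- rewrite <- Rmult_assoc, <- (Rmult_assoc (exp _)).
  apply Rmult_le_compat_l; trivial.
  apply Rmult_le_pos; apply Rlt_le, exp_pos.
- rewrite <- !exp_plus. apply exp_monotone.
  assert (exp (- Ln (2 * m)) <= 1) by (rewrite <- exp_0; apply exp_monotone; lra).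
  nra.
Qed.

Lemma exp_taylor_0 (J : nat) : exp_taylor J 0 = 1.
Proof.
unfold exp_taylor. induction J as [|J IH]; [rewrite sum_O; simpl; field|].
rewrite sum_n_S, IH, pow_i by lia. unfold Rdiv. ring.
Qed.

Lemma dterm_pair_bound (phi b a : R) (m : nat) : 0 < a ->
  Rabs (dterm phi b a (2 * m) - dterm phi b a (S (2 * m)))
  <= (Rabs b + a + a / 2) * exp (a / 2) * exp (- (1 + a / 2) * Ln m).
Proof.
intros Ha. pose proof (pair_bound phi b a 0 0 m Ha) as H.
rewrite !Rmult_0_r, exp_taylor_0, !Rmult_1_r in H. apply H. rewrite Rabs_R0. lra.
Qed.

Lemma ex_series_majorant (D : dirichlet_summable) (K a : R) : 0 < a ->
  ex_series (fun m => K * exp (- (1 + a / 2) * Ln m)).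
Proof.
intros Ha. destruct (D (1 + a / 2) ltac:(lra)) as [l Hl].
exists (K * l). exact (is_series_scal_l K _ _ Hl).
Qed.

Lemma real_analytic_eta (D : dirichlet_summable) (phi b a : R) :
  0 < a -> real_analytic (eta phi b) a.
Proof.
intros Ha.
set (Cf := fun n => cos (phi - b * Ln n) * exp (- a * Ln n)).
set (c := fun m j => Cf (2 * m)%nat * ((- Ln (2 * m)) ^ j / INR (fact j))
   - Cf (S (2 * m)) * ((- Ln (S (2 * m))) ^ j / INR (fact j))).
exists (fun j => Series (fun m => c m j)), (a / 2). split; [lra|].
intros y Hy.
replace (eta phi b (a + y)) with
  (Series (fun m => Cf (2 * m)%nat * exp (- Ln (2 * m) * y)
     - Cf (S (2 * m)) * exp (- Ln (S (2 * m)) * y))).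
2:{ assert (Hd : forall n, dterm phi b (a + y) n = Cf n * exp (- Ln n * y)).
    { intros n. unfold dterm, Cf. rewrite Rmult_assoc, <- exp_plus. do 2 f_equal. ring. }
    apply Series_ext. intros m. now rewrite !Hd. }
apply (double_pseries c (fun m y => Cf (2 * m)%nat * exp (- Ln (2 * m) * y)
     - Cf (S (2 * m)) * exp (- Ln (S (2 * m)) * y))
  (fun m => (Rabs b + a + a / 2) * exp (a / 2) * exp (- (1 + a / 2) * Ln m)) (a / 2)); trivial.
- lra.
- intros m J t Ht.
  replace (sum_n (fun j => c m j * t ^ j) J) with
    (Cf (2 * m)%nat * exp_taylor J (- Ln (2 * m) * t)
     - Cf (S (2 * m)) * exp_taylor J (- Ln (S (2 * m)) * t)).
  + now apply pair_bound.
  + unfold exp_taylor.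
    rewrite (sum_n_eq (fun j => c m j * t ^ j) (fun j =>
      Cf (2 * m)%nat * ((- Ln (2 * m) * t) ^ j / INR (fact j))
      + - 1 * (Cf (S (2 * m)) * ((- Ln (S (2 * m)) * t) ^ j / INR (fact j))))).
    * rewrite sum_n_add, !sum_n_scal. ring_R.
    * intros j. unfold c. rewrite !Rpow_mult_distr. unfold Rdiv. ring.
- now apply ex_series_majorant.
- intros m t _.
  apply (is_pseries_minus (K := R_AbsRing) (V := R_NormedModule)); apply is_pseries_exp_scal.
Qed.

(** * The value of zeta at 0 *)

Lemma sum_n_fst (u : nat -> C) (N : nat) : fst (sum_n u N) = sum_n (fun n => fst (u n)) N.
Proof.
induction N as [|N IH]; [now rewrite !sum_O|].
rewrite sum_n_S, <- IH, sum_Sn. reflexivity.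
Qed.

Lemma sum_n_snd (u : nat -> C) (N : nat) : snd (sum_n u N) = sum_n (fun n => snd (u n)) N.
Proof.
induction N as [|N IH]; [now rewrite !sum_O|].
rewrite sum_n_S, <- IH, sum_Sn. reflexivity.
Qed.

Lemma is_series_C (u : nat -> C) (l : C) :
  @is_series C_AbsRing C_NormedModule u l <->
  is_series (fun n => fst (u n)) (fst l) /\ is_series (fun n => snd (u n)) (snd l).
Proof.
split.
- intros H. split.
  + apply (filterlim_ext (fun N => fst (sum_n u N))); [apply sum_n_fst|].
    apply (filterlim_comp _ _ _ (sum_n u) fst eventually (locally l)); [exact H|].
    intros P [eps HP]. exists eps. intros y By. apply HP, By.
  + apply (filterlim_ext (fun N => snd (sum_n u N))); [apply sum_n_snd|].
    apply (filterlim_comp _ _ _ (sum_n u) snd eventually (locally l)); [exact H|].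
    intros P [eps HP]. exists eps. intros y By. apply HP, By.
- intros [H1 H2] P [eps HP].
  assert (B1 : eventually (fun N => ball (fst l) eps (sum_n (fun n => fst (u n)) N)))
    by (apply H1; now exists eps).
  assert (B2 : eventually (fun N => ball (snd l) eps (sum_n (fun n => snd (u n)) N)))
    by (apply H2; now exists eps).
  destruct B1 as [N1 B1]. destruct B2 as [N2 B2].
  exists (Nat.max N1 N2). intros N HN. apply HP. split.
  + rewrite sum_n_fst. apply B1. lia.
  + rewrite sum_n_snd. apply B2. lia.
Qed.

Lemma is_series_rot (phi : R) (u : nat -> C) (l : C) :
  @is_series C_AbsRing C_NormedModule u l -> is_series (fun n => rot phi (u n)) (rot phi l).
Proof.
intros H. apply is_series_C in H as [H1 H2]. unfold rot.
apply (is_series_sub_scal (sin phi) (fun n => cos phi * fst (u n)));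
  [exact (is_series_scal_l (cos phi) _ _ H1)|exact H2].
Qed.

Lemma rot_dirichlet_term (phi a b : R) (n : nat) :
  rot phi (dirichlet_term (a, b) n) = dterm phi b a n.
Proof.
unfold rot, dirichlet_term, Cexp, dterm. fold (Ln n). generalize (Ln n). intros L.
unfold Re, Im. simpl.
replace (- a * L - - b * 0) with (- a * L) by ring.
replace (- a * 0 + - b * L) with (- (b * L)) by ring.
rewrite cos_neg, sin_neg, cos_minus. ring.
Qed.

Lemma dirichlet_summable_of_zeta (zeta : C -> C) : is_riemann_zeta zeta -> dirichlet_summable.
Proof.
intros [H _] s Hs. specialize (H (s, 0) Hs).
apply (is_series_rot 0) in H. exists (rot 0 (zeta (s, 0))).
revert H. apply is_series_congr; trivial. intros n.
rewrite rot_dirichlet_term. unfold dterm. rewrite Rmult_0_l, Rminus_0_r, cos_0. ring.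
Qed.

Lemma RtoC_pow (y : R) (k : nat) :
  @pow_n C_Ring (RtoC y) k = RtoC (y ^ k).
Proof.
induction k as [|k IH]; [reflexivity|].
change (Cmult (RtoC y) (@pow_n C_Ring (RtoC y) k) = RtoC (y ^ S k)).
rewrite IH. simpl pow. now rewrite RtoC_mult.
Qed.

Lemma real_analytic_rot (f : C -> C) (phi a b : R) :
  analytic_at f (a, b) -> real_analytic (fun t => rot phi (f (t, b))) a.
Proof.
intros [A [eps [He H]]].
exists (fun n => rot phi (A n)), eps. split; trivial. intros y Hy.
assert (Ey : Cminus (a + y, b) (a, b) = RtoC y).
{ unfold Cminus, Cplus, Copp, RtoC. simpl. f_equal; ring. }
specialize (H (a + y, b)). rewrite Ey in H.
specialize (H ltac:(now rewrite Cmod_R)).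
apply is_pseries_R. apply (is_series_rot phi) in H. revert H.
apply is_series_congr; trivial. intros n.
unfold scal; simpl scal.
change (rot phi (@pow_n C_Ring (RtoC y) n * A n)%C = rot phi (A n) * y ^ n).
rewrite RtoC_pow. unfold rot, Cmult, RtoC. simpl fst. simpl snd. ring.
Qed.

Lemma rot_le (phi : R) (z : C) : Rabs (rot phi z) <= Rabs (fst z) + Rabs (snd z).
Proof.
unfold rot, Rminus. eapply Rle_trans; [apply Rabs_triang|]. rewrite Rabs_Ropp.
rewrite <- (Rmult_1_l (Rabs (fst z))), <- (Rmult_1_l (Rabs (snd z))).
apply Rplus_le_compat; apply Rabs_mult_le; try apply Rle_refl;
  apply Rabs_le; [apply COS_bound|apply SIN_bound].
Qed.

Lemma Cmod_pow_n (w : C) (k : nat) : Cmod (@pow_n C_Ring w k) = Cmod w ^ k.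
Proof.
induction k as [|k IH]; [exact Cmod_1|].
change (Cmod (w * @pow_n C_Ring w k)%C = Cmod w ^ S k).
now rewrite Cmod_mult, IH.
Qed.

Lemma rot_mult_le (phi : R) (w z : C) :
  Rabs (rot phi (w * z)%C) <= Cmod w * (2 * (Rabs (fst z) + Rabs (snd z))).
Proof.
eapply Rle_trans; [apply rot_le|].
pose proof (Rmax_Cmod w) as H.
assert (H1 : Rabs (fst w) <= Cmod w) by (eapply Rle_trans; [apply Rmax_l|exact H]).
assert (H2 : Rabs (snd w) <= Cmod w) by (eapply Rle_trans; [apply Rmax_r|exact H]).
unfold Cmult. simpl fst. simpl snd.
pose proof (Rabs_mult_le _ _ _ _ H1 (Rle_refl (Rabs (fst z)))).
pose proof (Rabs_mult_le _ _ _ _ H1 (Rle_refl (Rabs (snd z)))).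
pose proof (Rabs_mult_le _ _ _ _ H2 (Rle_refl (Rabs (fst z)))).
pose proof (Rabs_mult_le _ _ _ _ H2 (Rle_refl (Rabs (snd z)))).
pose proof (Rabs_triang (fst w * fst z) (- (snd w * snd z))) as T1. rewrite Rabs_Ropp in T1.
pose proof (Rabs_triang (fst w * snd z) (snd w * fst z)) as T2.
unfold Rminus. lra.
Qed.

Lemma pseries_coef_bounded (a : nat -> R) (r : R) : ex_pseries a r ->
  exists M, 0 < M /\ forall k, Rabs (a k * r ^ k) <= M.
Proof.
intros [l Hl]. apply (maj_by_pos (fun k => a k * r ^ k)). exists 0.
apply is_lim_seq_Reals, ex_series_lim_0. exists l. apply is_pseries_R, Hl.
Qed.

(** Convergence at [eps / 2] bounds the coefficients, and for [Cmod w <= eps / 4] the series beyond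
    its constant term is dominated by a geometric one of ratio at most 1/2. The constant does not
    depend on [phi], so the angle may vary in the limit. *)
Lemma analytic_lipschitz (f : C -> C) (z0 : C) : analytic_at f z0 ->
  exists K d, 0 < d /\ forall phi w, Cmod w <= d ->
    Rabs (rot phi (f (z0 + w)%C) - rot phi (f z0)) <= K * Cmod w.
Proof.
intros [A [eps [He H]]].
assert (Hser : forall w phi, Cmod w < eps ->
  is_series (fun k => rot phi (@pow_n C_Ring w k * A k)%C) (rot phi (f (z0 + w)%C))).
{ intros w phi Hw. specialize (H (z0 + w)%C).
  replace (z0 + w - z0)%C with w in H by ring.
  exact (is_series_rot phi _ _ (H Hw)). }
assert (Hr : Cmod (RtoC (eps / 2)) < eps) by (rewrite Cmod_R, Rabs_pos_eq; lra).
assert (Hcomp : forall phi, ex_pseries (fun k => rot phi (A k)) (eps / 2)).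
{ intros phi. exists (rot phi (f (z0 + RtoC (eps / 2))%C)). apply is_pseries_R.
  generalize (Hser _ phi Hr). apply is_series_congr; trivial. intros k.
  rewrite RtoC_pow. unfold rot, Cmult, RtoC. simpl fst. simpl snd. ring. }
destruct (pseries_coef_bounded _ _ (Hcomp 0)) as [M1 [HM1 B1]].
destruct (pseries_coef_bounded _ _ (Hcomp (- (PI / 2)))) as [M2 [HM2 B2]].
set (M := 2 * (M1 + M2)).
assert (HA : forall k, 2 * (Rabs (fst (A k)) + Rabs (snd (A k))) * (eps / 2) ^ k <= M).
{ intros k. specialize (B1 k). specialize (B2 k).
  unfold rot in B1, B2. rewrite cos_0, sin_0 in B1.
  rewrite cos_neg, sin_neg, cos_PI2, sin_PI2 in B2.
  assert (Hp : 0 <= (eps / 2) ^ k) by (apply pow_le; lra).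
  rewrite Rabs_mult, (Rabs_pos_eq (_ ^ _)) in B1, B2 by trivial.
  replace (1 * fst (A k) - 0 * snd (A k)) with (fst (A k)) in B1 by ring.
  replace (0 * fst (A k) - - (1) * snd (A k)) with (snd (A k)) in B2 by ring.
  unfold M. lra. }
assert (Hmain : forall phi w, Cmod w <= eps / 4 ->
  Rabs (rot phi (f (z0 + w)%C) - rot phi (A 0%nat)) <= 2 * M * (Cmod w / (eps / 2))).
{ intros phi w Hw. pose proof (Cmod_ge_0 w) as Hw0.
  set (q := Cmod w / (eps / 2)).
  assert (Hq : 0 <= q <= / 2).
  { split; [apply Rcomplements.Rdiv_le_0_compat; lra|].
    apply Rcomplements.Rle_div_l; lra. }
  assert (Hqw : Cmod w = q * (eps / 2)) by (unfold q; field; lra).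
  specialize (Hser w phi ltac:(lra)).
  assert (Hterm : forall k, Rabs (rot phi (@pow_n C_Ring w k * A k)%C) <= M * q ^ k).
  { intros k. eapply Rle_trans; [apply rot_mult_le|].
    rewrite Cmod_pow_n, Hqw, Rpow_mult_distr.
    specialize (HA k). pose proof (pow_le q k ltac:(lra)). nra. }
  (* The factor [2 * q * (1 - (/ 2) ^ n)] sums the bounds [q ^ k <= q * (/ 2) ^ (k - 1)] for [k]
     from 1 to [n], in a form suited to induction. *)
  assert (Hfin : forall n, Rabs (sum_n (fun k => rot phi (@pow_n C_Ring w k * A k)%C) n
      - rot phi (A 0%nat)) <= M * (2 * q * (1 - (/ 2) ^ n))).
  { induction n as [|n IH].
    - rewrite sum_O. change (@pow_n C_Ring w 0) with (RtoC 1). rewrite Cmult_1_l.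
      replace (rot phi (A 0%nat) - rot phi (A 0%nat)) with 0 by ring.
      rewrite Rabs_R0. simpl. lra.
    - rewrite sum_n_S.
      match goal with |- Rabs (?a + ?b - ?c) <= _ => replace (a + b - c) with ((a - c) + b) by ring end.
      eapply Rle_trans; [apply Rabs_triang|].
      specialize (Hterm (S n)).
      assert (Hp : q ^ S n <= q * (/ 2) ^ n).
      { simpl. apply Rmult_le_compat_l; [lra|]. apply pow_incr. lra. }
      simpl ((/ 2) ^ S n). assert (0 <= M) by (unfold M; lra).
      assert (M * q ^ S n <= M * (q * (/ 2) ^ n)) by (apply Rmult_le_compat_l; lra).
      lra. }
  assert (L : Rbar_le (Rabs (rot phi (f (z0 + w)%C) - rot phi (A 0%nat))) (2 * M * q)); [|exact L].
  apply (is_lim_seq_le (fun n => Rabs (sum_n (fun k => rot phi (@pow_n C_Ring w k * A k)%C) n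
      - rot phi (A 0%nat))) (fun _ => 2 * M * q)).
  - intros n. eapply Rle_trans; [apply Hfin|].
    assert (0 <= M) by (unfold M; lra). assert (0 <= (/ 2) ^ n) by (apply pow_le; lra).
    assert (0 <= M * q) by (apply Rmult_le_pos; lra). nra.
  - apply (is_lim_seq_abs _ (rot phi (f (z0 + w)%C) - rot phi (A 0%nat))).
    apply is_lim_seq_minus'; [exact Hser|apply is_lim_seq_const].
  - apply is_lim_seq_const. }
assert (H0 : forall phi, rot phi (f z0) = rot phi (A 0%nat)).
{ intros phi. pose proof (Hmain phi (RtoC 0)) as E. rewrite Cplus_0_r, Cmod_R, Rabs_R0 in E.
  specialize (E ltac:(lra)). unfold Rdiv in E. rewrite Rmult_0_l, Rmult_0_r in E.
  apply Rabs_le_between in E. lra. }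
exists (2 * M / (eps / 2)), (eps / 4). split; [lra|]. intros phi w Hw. rewrite H0.
eapply Rle_trans; [now apply Hmain|]. right. field. lra.
Qed.

(** The angle moves with [k] because the factor [2^(-ib)] is absorbed as the shift [phi - b * ln 2],
    and [b] tends to 0. *)
Lemma rot_lim (f : C -> C) (z0 : C) (w : nat -> C) (phi : nat -> R) (phi0 : R) :
  analytic_at f z0 -> is_lim_seq (fun k => Cmod (w k)) 0 -> is_lim_seq phi phi0 ->
  is_lim_seq (fun k => rot (phi k) (f (z0 + w k)%C)) (rot phi0 (f z0)).
Proof.
intros Hf Hw Hphi.
destruct (analytic_lipschitz f z0 Hf) as [K [d [Hd H]]].
assert (L1 : is_lim_seq (fun k => rot (phi k) (f z0)) (rot phi0 (f z0))).
{ apply (is_lim_seq_continuous (fun t => rot t (f z0))); trivial.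
  apply continuity_pt_filterlim, (ex_derive_continuous (fun t => rot t (f z0))).
  unfold rot. auto_derive. trivial. }
assert (L2 : is_lim_seq (fun k => rot (phi k) (f (z0 + w k)%C) - rot (phi k) (f z0)) 0).
{ apply is_lim_seq_abs_0.
  apply (is_lim_seq_le_le_loc (fun _ => 0) _ (fun k => K * Cmod (w k))).
  - destruct (proj2 (is_lim_seq_spec _ _) Hw (mkposreal d Hd)) as [N HN].
    exists N. intros n Hn. split; [apply Rabs_pos|]. apply H.
    specialize (HN n Hn). simpl in HN. rewrite Rminus_0_r, Rabs_pos_eq in HN by apply Cmod_ge_0.
    lra.
  - apply is_lim_seq_const.
  - replace (Finite 0) with (Rbar_mult K 0) by (simpl; f_equal; ring).
    now apply is_lim_seq_scal_l. }
replace (Finite (rot phi0 (f z0))) with (Finite (0 + rot phi0 (f z0))) by (f_equal; ring).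
apply (is_lim_seq_ext (fun k => (rot (phi k) (f (z0 + w k)%C) - rot (phi k) (f z0))
  + rot (phi k) (f z0))); [intros n; ring|].
now apply is_lim_seq_plus'.
Qed.

Lemma dterm_double (phi b a : R) (m : nat) :
  dterm phi b a (S (2 * m)) = exp (- a * ln 2) * dterm (phi - b * ln 2) b a m.
Proof.
unfold dterm. rewrite Ln_double.
replace (phi - b * (ln 2 + Ln m)) with (phi - b * ln 2 - b * Ln m) by ring.
replace (- a * (ln 2 + Ln m)) with (- a * ln 2 + - a * Ln m) by ring.
rewrite exp_plus. ring.
Qed.

(** The terms at even integers are [2^(-s)] times the whole series, by [dterm_double]; subtracting
    them twice makes the signs alternate. The first [M + 1] pairs use exactly the indices 0 to
    [2 * M + 1]. *)
Lemma eta_zeta_half_plane (zeta : C -> C) (H : is_riemann_zeta zeta) (phi b a : R) : 1 < a ->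
  eta phi b a = rot phi (zeta (a, b))
    - 2 * exp (- a * ln 2) * rot (phi - b * ln 2) (zeta (a, b)).
Proof.
intros Ha.
assert (HS : forall t, is_series (dterm t b a) (rot t (zeta (a, b)))).
{ intros t. generalize (is_series_rot t _ _ (proj1 H (a, b) Ha)).
  apply is_series_congr; trivial. intros n. apply rot_dirichlet_term. }
apply is_series_unique.
change (is_lim_seq (sum_n (fun m => dterm phi b a (2 * m) - dterm phi b a (S (2 * m))))
  (rot phi (zeta (a, b)) - 2 * exp (- a * ln 2) * rot (phi - b * ln 2) (zeta (a, b)))).
apply (is_lim_seq_ext (fun M => sum_n (dterm phi b a) (2 * M + 1)
  - 2 * exp (- a * ln 2) * sum_n (dterm (phi - b * ln 2) b a) M)).
{ induction n as [|M IH].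
  - replace (2 * 0 + 1)%nat with 1%nat by lia. rewrite sum_n_S, !sum_O.
    pose proof (dterm_double phi b a 0) as E. change (2 * 0)%nat with 0%nat in *.
    rewrite E. ring_R.
  - rewrite !sum_n_S, <- IH.
    replace (2 * S M + 1)%nat with (S (S (2 * M + 1))) by lia.
    rewrite !sum_n_S. replace (S (2 * M + 1)) with (2 * S M)%nat by lia.
    rewrite dterm_double. ring_R. }
apply is_lim_seq_minus'.
- apply (is_lim_seq_subseq (sum_n (dterm phi b a)) (rot phi (zeta (a, b)))
    (fun M => (2 * M + 1)%nat)); [apply eventually_subseq; intros n; lia|apply HS].
- apply (is_lim_seq_scal_l _ _ (rot (phi - b * ln 2) (zeta (a, b)))), HS.
Qed.

(* The horizontal line through [i b] avoids the pole when [b <> 0]. *)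
Lemma eta_zeta (zeta : C -> C) (H : is_riemann_zeta zeta) (phi b a : R) : b <> 0 -> 0 < a ->
  eta phi b a = rot phi (zeta (a, b))
    - 2 * exp (- a * ln 2) * rot (phi - b * ln 2) (zeta (a, b)).
Proof.
intros Hb Ha.
apply Rminus_diag_uniq.
apply (real_analytic_zero (fun t => eta phi b t - (rot phi (zeta (t, b))
    - 2 * exp (- t * ln 2) * rot (phi - b * ln 2) (zeta (t, b)))) 0 1); trivial.
- intros x Hx.
  assert (Han : forall t, real_analytic (fun x => rot t (zeta (x, b))) x).
  { intros t. apply real_analytic_rot, (proj2 H). intros E. injection E as _ E. now apply Hb. }
  apply real_analytic_minus; [|apply real_analytic_minus; [|apply real_analytic_mult]]; trivial.
  + apply real_analytic_eta; trivial. now apply (dirichlet_summable_of_zeta zeta).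
  + apply (real_analytic_ext (fun t => 2 * exp (- ln 2 * t))); [|apply real_analytic_exp].
    intros t. do 2 f_equal. ring.
- intros x Hx. rewrite (eta_zeta_half_plane zeta H) by trivial. ring.
Qed.

Lemma lim_eta_b (D : dirichlet_summable) (phi a : R) (b : nat -> R) : 0 < a ->
  (forall k, Rabs (b k) <= 1) -> is_lim_seq b 0 ->
  is_lim_seq (fun k => eta phi (b k) a) (eta phi 0 a).
Proof.
intros Ha Hb Lb.
apply (tannery (fun k m => dterm phi (b k) a (2 * m) - dterm phi (b k) a (S (2 * m))) _
  (fun m => (1 + a + a / 2) * exp (a / 2) * exp (- (1 + a / 2) * Ln m))).
- intros k m. eapply Rle_trans; [now apply dterm_pair_bound|].
  apply Rmult_le_compat_r; [apply Rlt_le, exp_pos|].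
  apply Rmult_le_compat_r; [apply Rlt_le, exp_pos|]. specialize (Hb k). lra.
- now apply ex_series_majorant.
- intros m.
  assert (L : forall n, is_lim_seq (fun k => dterm phi (b k) a n) (dterm phi 0 a n)).
  { intros n. apply (is_lim_seq_continuous (fun t => dterm phi t a n)); trivial.
    apply continuity_pt_filterlim, (ex_derive_continuous (fun t => dterm phi t a n)).
    unfold dterm. auto_derive. trivial. }
  now apply is_lim_seq_minus'.
Qed.

Lemma eta_zeta_real (zeta : C -> C) (H : is_riemann_zeta zeta) (phi a : R) : 0 < a < 1 ->
  eta phi 0 a = (1 - 2 * exp (- a * ln 2)) * rot phi (zeta (a, 0)).
Proof.
intros Ha.
set (b := fun k => 1 / (INR (S k) + / 2)).
assert (Lb : is_lim_seq b 0) by apply lim_div_half_integer.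
assert (Hb : forall k, 0 < b k <= 1).
{ intros k. assert (1 < INR (S k) + / 2) by (rewrite S_INR; pose proof (pos_INR k); lra).
  split; [apply Rdiv_lt_0_compat; lra|]. apply Rcomplements.Rle_div_l; lra. }
assert (Hz : analytic_at zeta (a, 0)).
{ apply (proj2 H). intros E. injection E as E. lra. }
assert (Ew : forall k, (a, b k) = Cplus (a, 0) (0, b k)).
{ intros k. unfold Cplus. simpl. f_equal; ring. }
assert (Hw : is_lim_seq (fun k => Cmod (0, b k)) 0).
{ apply (is_lim_seq_ext b); trivial. intros k. unfold Cmod. simpl.
  replace (0 * (0 * 1) + b k * (b k * 1)) with (Rsqr (b k)) by (unfold Rsqr; ring).
  specialize (Hb k). rewrite sqrt_Rsqr; lra. }
pose proof (lim_eta_b (dirichlet_summable_of_zeta zeta H) phi a b (proj1 Ha)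
  (fun k => ltac:(rewrite Rabs_pos_eq; specialize (Hb k); lra)) Lb) as L1.
assert (L2 : is_lim_seq (fun k => rot phi (zeta (a, b k))
    - 2 * exp (- a * ln 2) * rot (phi - b k * ln 2) (zeta (a, b k)))
  (rot phi (zeta (a, 0)) - 2 * exp (- a * ln 2) * rot phi (zeta (a, 0)))).
{ apply is_lim_seq_minus'.
  - apply (is_lim_seq_ext (fun k => rot phi (zeta (Cplus (a, 0) (0, b k))))).
    + intros k. now rewrite <- Ew.
    + apply (rot_lim zeta (a, 0) (fun k => (0, b k)) (fun _ => phi)); trivial.
      apply is_lim_seq_const.
  - apply (is_lim_seq_scal_l _ _ (rot phi (zeta (a, 0)))).
    apply (is_lim_seq_ext (fun k => rot (phi - b k * ln 2) (zeta (Cplus (a, 0) (0, b k))))).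
    + intros k. now rewrite <- Ew.
    + apply (rot_lim zeta (a, 0) (fun k => (0, b k)) (fun k => phi - b k * ln 2)); trivial.
      replace (Finite phi) with (Finite (phi - 0 * ln 2)) by (f_equal; ring).
      apply is_lim_seq_minus'; [apply is_lim_seq_const|].
      now apply (is_lim_seq_scal_r b (ln 2) 0). }
apply (is_lim_seq_ext _ (fun k => eta phi (b k) a)) in L2.
2:{ intros k. symmetry. apply eta_zeta; trivial; [|lra]. specialize (Hb k). lra. }
apply is_lim_seq_unique in L1. apply is_lim_seq_unique in L2.
rewrite L1 in L2. injection L2 as L2. rewrite L2. ring.
Qed.

(** From [(n+1)(n+3) <= (n+2)^2] the middle term is at most the geometric mean [u * v] of the outer
    ones, hence at most their arithmetic mean. *)
Lemma exp_Ln_convex (a : R) (n : nat) : 0 < a ->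
  exp (- a * Ln (S n)) - exp (- a * Ln (S (S n))) <= exp (- a * Ln n) - exp (- a * Ln (S n)).
Proof.
intros Ha.
set (u := exp (- a * Ln n / 2)). set (v := exp (- a * Ln (S (S n)) / 2)).
assert (Eu : exp (- a * Ln n) = u * u) by (unfold u; rewrite <- exp_plus; f_equal; field).
assert (Ev : exp (- a * Ln (S (S n))) = v * v) by (unfold v; rewrite <- exp_plus; f_equal; field).
assert (L : Ln n + Ln (S (S n)) <= 2 * Ln (S n)).
{ unfold Ln. replace (2 * ln (INR (S (S n)))) with (ln (INR (S (S n))) + ln (INR (S (S n)))) by ring.
  rewrite <- !ln_mult by (apply lt_0_INR; lia).
  apply Rcomplements.ln_le.
  - apply Rmult_lt_0_compat; apply lt_0_INR; lia.
  - rewrite (S_INR (S (S n))), (S_INR (S n)). nra. }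
assert (E : exp (- a * Ln (S n)) <= u * v).
{ unfold u, v. rewrite <- exp_plus. apply exp_monotone. nra. }
rewrite Eu, Ev. pose proof (Rle_0_sqr (u - v)) as Q. unfold Rsqr in Q. lra.
Qed.

Lemma lim_exp_Ln (a : R) : 0 < a -> is_lim_seq (fun n => exp (- a * Ln n)) 0.
Proof.
intros Ha.
apply (is_lim_comp_seq exp _ m_infty); [apply is_lim_exp_m|now exists 0%nat|].
replace m_infty with (Rbar_mult (- a) p_infty).
2:{ unfold Rbar_mult, Rbar_mult'. destruct (Rle_dec 0 (- a)) as [H|H]; [exfalso; lra|reflexivity]. }
apply is_lim_seq_scal_l. unfold Ln.
apply (is_lim_comp_seq ln _ p_infty); [apply is_lim_ln_p|now exists 0%nat|].
apply (is_lim_seq_le_p_loc INR); [|apply is_lim_seq_INR].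
exists 0%nat. intros n _. apply le_INR. lia.
Qed.

(* The even-indexed and odd-indexed differences of the convex null sequence
   [n^(-a)] add up to 1, and each half dominates the other up to the first term. *)
Lemma eta_real_bounds (D : dirichlet_summable) (a : R) : 0 < a ->
  / 2 <= eta 0 0 a <= / 2 + (1 - exp (- a * Ln 1)) / 2.
Proof.
intros Ha.
set (d := fun n => exp (- a * Ln n) - exp (- a * Ln (S n))).
assert (Hd : forall n, d (S n) <= d n) by (intros n; now apply exp_Ln_convex).
assert (Hd0 : forall n, 0 <= d n).
{ intros n. unfold d. pose proof (Ln_mono n (S n) ltac:(lia)).
  enough (exp (- a * Ln (S n)) <= exp (- a * Ln n)) by lra. apply exp_monotone. nra. }
assert (L : is_lim_seq (sum_n (fun m => d (2 * m)%nat)) (eta 0 0 a)).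
{ assert (Ex : ex_series (fun m => d (2 * m)%nat)).
  { apply (ex_series_le (K := R_AbsRing) (V := R_CompleteNormedModule) _
      (fun m => (Rabs 0 + a + a / 2) * exp (a / 2) * exp (- (1 + a / 2) * Ln m)));
    [|now apply ex_series_majorant].
    intros m. pose proof (dterm_pair_bound 0 0 a m Ha) as B.
    unfold dterm in B. rewrite !Rmult_0_l, Rminus_0_r, cos_0, !Rmult_1_l in B. exact B. }
  apply Series_correct in Ex. replace (eta 0 0 a) with (Series (fun m => d (2 * m)%nat)); [exact Ex|].
  apply Series_ext. intros m. unfold d, dterm.
  rewrite !Rmult_0_l, Rminus_0_r, cos_0. ring. }
(* The sum [A + B] telescopes to [1 - (2M+3)^(-a)]. The inequalities compare [d (2m)] with its right
   neighbour and, once the first term is removed, with its left neighbour. *)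
assert (I : forall M, let A := sum_n (fun m => d (2 * m)%nat) M in
  let B := sum_n (fun m => d (S (2 * m))) M in
  A + B = 1 - exp (- a * Ln (2 * S M)) /\ B <= A /\ A - d 0%nat <= B - d (S (2 * M))).
{ induction M as [|M IH]; cbv zeta in *.
  - rewrite !sum_O. change (2 * 1)%nat with 2%nat.
    change (2 * 0)%nat with 0%nat. pose proof (Hd 0%nat). unfold d at 1 2.
    assert (exp (- a * Ln 0) = 1) by (unfold Ln; simpl; rewrite ln_1, Rmult_0_r; apply exp_0).
    lra.
  - rewrite !sum_n_S. destruct IH as [I1 [I2 I3]].
    replace (2 * S (S M))%nat with (S (S (2 * S M))) by lia.
    pose proof (Hd (2 * S M)%nat) as H1. pose proof (Hd (S (2 * M))) as H2.
    replace (S (S (2 * M))) with (2 * S M)%nat in H2 by lia.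
    split; [|lra]. unfold d at 2 4. lra. }
assert (E0 : d 0%nat = 1 - exp (- a * Ln 1)).
{ unfold d, Ln at 1. simpl INR. rewrite ln_1, Rmult_0_r, exp_0. reflexivity. }
split.
- assert (H : Rbar_le (/ 2) (eta 0 0 a)); [|exact H].
  apply (is_lim_seq_le (fun M => / 2 - exp (- a * Ln (2 * S M)) * / 2)
    (sum_n (fun m => d (2 * m)%nat))); [| |exact L].
  + intros M. destruct (I M) as [I1 [I2 I3]]. cbv zeta in *. lra.
  + replace (Finite (/ 2)) with (Finite (/ 2 - 0 * / 2)) by (f_equal; ring).
    apply is_lim_seq_minus'; [apply is_lim_seq_const|].
    apply (is_lim_seq_scal_r _ (/ 2) 0).
    apply (is_lim_seq_subseq (fun n => exp (- a * Ln n)) 0 (fun M => (2 * S M)%nat));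
      [apply eventually_subseq; intros n; lia|now apply lim_exp_Ln].
- assert (H : Rbar_le (eta 0 0 a) (/ 2 + (1 - exp (- a * Ln 1)) / 2)); [|exact H].
  apply (is_lim_seq_le (sum_n (fun m => d (2 * m)%nat)) (fun _ => / 2 + (1 - exp (- a * Ln 1)) / 2));
    [|exact L|apply is_lim_seq_const].
  intros M. destruct (I M) as [I1 [I2 I3]]. cbv zeta in *.
  specialize (Hd0 (S (2 * M))). pose proof (exp_pos (- a * Ln (2 * S M))).
  rewrite <- E0. lra.
Qed.

(** As [a] decreases to 0, [eta] is squeezed to 1/2 while the factor [1 - 2^(1-a)] tends to -1. *)
Lemma zeta_0 (zeta : C -> C) (H : is_riemann_zeta zeta) : zeta (RtoC 0) = RtoC (- / 2).
Proof.
set (a := fun k => 1 / (INR (S k) + / 2)).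
assert (La : is_lim_seq a 0) by apply lim_div_half_integer.
assert (Ha : forall k, 0 < a k < 1).
{ intros k. assert (1 < INR (S k) + / 2) by (rewrite S_INR; pose proof (pos_INR k); lra).
  split; [apply Rdiv_lt_0_compat; lra|]. apply Rcomplements.Rlt_div_l; lra. }
assert (Le : forall c, is_lim_seq (fun k => exp (- a k * c)) 1).
{ intros c. replace (Finite 1) with (Finite (exp (- 0 * c))).
  2:{ f_equal. rewrite <- exp_0. f_equal. ring. }
  apply (is_lim_seq_continuous (fun t => exp (- t * c))); trivial.
  apply continuity_pt_filterlim, (ex_derive_continuous (fun t => exp (- t * c))).
  auto_derive. trivial. }
assert (Leta : is_lim_seq (fun k => eta 0 0 (a k)) (/ 2)).
{ apply (is_lim_seq_le_le (fun _ => / 2) _ (fun k => / 2 + (1 - exp (- a k * Ln 1)) * / 2)).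
  - intros k. now apply eta_real_bounds; [apply (dirichlet_summable_of_zeta zeta)|apply Ha].
  - apply is_lim_seq_const.
  - replace (Finite (/ 2)) with (Finite (/ 2 + (1 - 1) * / 2)) by (f_equal; ring).
    apply is_lim_seq_plus'; [apply is_lim_seq_const|].
    apply (is_lim_seq_scal_r _ (/ 2) (1 - 1)).
    apply is_lim_seq_minus'; [apply is_lim_seq_const|apply Le]. }
assert (Hz : analytic_at zeta (RtoC 0)).
{ apply (proj2 H). intros E. injection E as E. lra. }
assert (Hrot : forall phi, rot phi (zeta (RtoC 0)) = - (cos phi * / 2)).
{ intros phi.
  assert (L1 : is_lim_seq (fun k => cos phi * eta 0 0 (a k)) (cos phi * / 2))
    by now apply (is_lim_seq_scal_l _ (cos phi) (/ 2)).
  assert (L2 : is_lim_seq (fun k => (1 - 2 * exp (- a k * ln 2)) *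
    rot phi (zeta (Cplus (RtoC 0) (RtoC (a k))))) ((1 - 2 * 1) * rot phi (zeta (RtoC 0)))).
  { apply is_lim_seq_mult'.
    - apply is_lim_seq_minus'; [apply is_lim_seq_const|].
      apply (is_lim_seq_scal_l _ 2 1), Le.
    - apply (rot_lim zeta (RtoC 0) (fun k => RtoC (a k)) (fun _ => phi)); trivial.
      + apply (is_lim_seq_ext a); trivial. intros k. rewrite Cmod_R, Rabs_pos_eq; trivial.
        apply Rlt_le, Ha.
      + apply is_lim_seq_const. }
  apply (is_lim_seq_ext _ (fun k => cos phi * eta 0 0 (a k))) in L2.
  - apply is_lim_seq_unique in L1. apply is_lim_seq_unique in L2.
    rewrite L1 in L2. injection L2 as L2. lra.
  - intros k. rewrite Cplus_0_l. symmetry.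
    change (RtoC (a k)) with ((a k, 0) : C).
    rewrite <- (eta_zeta_real zeta H phi (a k) (Ha k)).
    (* For [b = 0] the phase is the same in every term, so [cos phi] factors out of [eta]. *)
    unfold eta. rewrite <- Series_scal_l. apply Series_ext. intros m.
    unfold dterm. rewrite !Rmult_0_l, !Rminus_0_r, cos_0. ring. }
pose proof (Hrot 0) as R1. pose proof (Hrot (- (PI / 2))) as R2. unfold rot in R1, R2.
rewrite cos_0, sin_0 in R1. rewrite cos_neg, sin_neg, cos_PI2, sin_PI2 in R2.
destruct (zeta (RtoC 0)) as [u v]. simpl in R1, R2. unfold RtoC. f_equal; lra.
Qed.

(** * Transfer of the real identity to complex zeta values *)

Lemma is_series_RtoC (u : nat -> R) (l : R) :
  is_series u l -> @is_series C_AbsRing C_NormedModule (fun n => RtoC (u n)) (RtoC l).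
Proof. intros H. apply is_series_C. split; [exact H|exact is_series_R0]. Qed.

Lemma sum_n_m_RtoC (u : nat -> R) (p q : nat) :
  sum_n_m (fun n => RtoC (u n)) p q = RtoC (sum_n_m u p q).
Proof.
destruct (Nat.le_gt_cases p (S q)) as [Hpq|Hpq].
- induction q as [|q IH].
  + destruct p as [|[|p]]; [rewrite !sum_n_n; trivial|rewrite !sum_n_m_zero by lia; trivial|lia].
  + destruct (Nat.eq_dec p (S (S q))) as [->|Hne]; [rewrite !sum_n_m_zero by lia; trivial|].
    rewrite !sum_n_Sm, IH by lia. symmetry. apply RtoC_plus.
- rewrite !sum_n_m_zero by lia. trivial.
Qed.

(** On the real axis every term of the rotated series carries the factor [cos phi]. The angle
    [- (PI / 2)] therefore gives the zero series, so the imaginary part vanishes. *)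
Lemma zeta_nat (zeta : C -> C) (H : is_riemann_zeta zeta) (s : nat) : (2 <= s)%nat ->
  is_series (fun n => / INR (S n) ^ s) (fst (zeta (RtoC (INR s)))) /\
  zeta (RtoC (INR s)) = RtoC (fst (zeta (RtoC (INR s)))).
Proof.
intros Hs.
assert (H1 : 1 < INR s) by (apply (lt_INR 1); lia).
assert (Hser : forall phi, is_series (fun n => cos phi * / INR (S n) ^ s)
  (rot phi (zeta (RtoC (INR s))))).
{ intros phi. generalize (is_series_rot phi _ _ (proj1 H (RtoC (INR s)) H1)).
  apply is_series_congr; trivial. intros n. unfold RtoC. rewrite rot_dirichlet_term.
  unfold dterm. rewrite Rmult_0_l, Rminus_0_r. f_equal.
  rewrite Ropp_mult_distr_l_reverse, exp_Ropp. f_equal.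
  unfold Ln. rewrite <- ln_pow by (apply lt_0_INR; lia).
  apply exp_ln, pow_lt, lt_0_INR. lia. }
pose proof (Hser 0) as S0. pose proof (Hser (- (PI / 2))) as S1.
unfold rot in S0, S1. rewrite cos_0, sin_0 in S0. rewrite cos_neg, sin_neg, cos_PI2, sin_PI2 in S1.
split.
- revert S0. apply is_series_congr; [intros n|]; ring.
- assert (E : 0 * fst (zeta (RtoC (INR s))) - - (1) * snd (zeta (RtoC (INR s))) = 0).
  { apply is_series_unique in S1. rewrite <- S1. apply is_series_unique.
    generalize is_series_R0. apply is_series_congr; trivial. intros n. ring. }
  destruct (zeta (RtoC (INR s))) as [u v]. simpl in *. unfold RtoC. f_equal. lra.
Qed.

Close Scope R_scope.

Theorem theorem4p4 (zeta : C -> C) (Hzeta : is_riemann_zeta zeta)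
    (r : nat) (Hr : (2 <= r)%nat) :
  exists T : C,
    @is_series C_AbsRing C_NormedModule
      (fun k : nat =>
         (RtoC (INR (fact (2 * k)) * INR (4 * r + 2 * k - 1)
                / INR (fact (2 * r + 2 * k)))
          * (zeta (RtoC (INR (2 * k))) / RtoC (3 ^ (2 * k))))%C)
      T /\
    zeta (RtoC (INR (2 * r + 1))) =
      (- RtoC (2 * PI ^ 2 * (3 ^ (2 * r - 2) - 1)
               / (INR r * INR (2 * r - 1) * (3 ^ (2 * r + 1) - 1)))
         * zeta (RtoC (INR (2 * r - 1)))
       + RtoC (2 * 3 ^ (2 * r)
               / (INR r * INR (2 * r - 1) * (3 ^ (2 * r + 1) - 1)))
         * (sum_n_m
              (fun k : nat =>
                 (RtoC ((-1) ^ (k - 1)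
                        * (INR (r - k) * INR (2 * r + 2 * k - 1)
                           / INR (fact (2 * k)))
                        * (2 * PI / 3) ^ (2 * k))
                  * zeta (RtoC (INR (2 * r + 1 - 2 * k))))%C)
              1 (r - 1)
            + RtoC ((-1) ^ r * (2 * PI / 3) ^ (2 * r)) * T))%C.
Proof.
set (z := fun s => fst (zeta (RtoC (INR s)))).
(* Only the pole is excluded. The arguments in the theorem are even or odd and at least 3, since
   [r >= 2] and [k <= r - 1] in the finite sum. *)
assert (Ez : forall s, s <> 1%nat -> zeta (RtoC (INR s)) = RtoC (z s)).
{ intros [|s] Hs.
  - unfold z. simpl INR. now rewrite zeta_0.
  - apply zeta_nat; trivial. lia. }
assert (Hz : zeta_values z).
{ split.
  - unfold z. simpl INR. now rewrite zeta_0.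
  - intros s Hs. now apply zeta_nat. }
destruct (zeta_odd_real z Hz r Hr) as [T [HT E]].
exists (RtoC T). split.
- apply is_series_RtoC in HT. revert HT. apply is_series_ext. intros k.
  rewrite (Ez (2 * k)%nat) by lia.
  rewrite RtoC_mult, (RtoC_div (z (2 * k)%nat)); [trivial|].
  apply pow_nonzero. lra.
- rewrite (Ez (2 * r + 1)%nat), (Ez (2 * r - 1)%nat), E by lia.
  rewrite (sum_n_m_ext_loc _ (fun k => RtoC ((-1) ^ (k - 1) * (INR (r - k) * INR (2 * r + 2 * k - 1)
                    / INR (fact (2 * k))) * (2 * PI / 3) ^ (2 * k)
                  * z (2 * r + 1 - 2 * k)%nat))).
  2:{ intros k Hk. rewrite Ez by lia. symmetry. apply RtoC_mult. }
  rewrite sum_n_m_RtoC.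
  now rewrite <- RtoC_opp, <- !RtoC_mult, <- RtoC_plus, <- !RtoC_mult, <- RtoC_plus.
Qed.
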